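(* Let $k\ge 0$ be an integer, $p>2\max\{k\}+1$, $q>-1$ and $\upsilon=1,2,\dots$. The finite bivariate M-Konhauser polynomials have the integral representation $${}_{K}M_{k;\upsilon}^{(p,q)}(y,z)=\frac{(-1)^{k+1}\Gamma(k+q+1)}{4\pi^2\,\Gamma(k+1-p)}\int_{-\infty}^{0^+}\!\int_{-\infty}^{0^+}\!\int_{0}^{\infty}e^{-u_1+w_1+w_2}\,u_1^{k-p}\,w_1^{-q-1}\,w_2^{p+q-1}\left(\frac{w_2^{\upsilon}-z^{\upsilon}}{w_2^{\upsilon}}+\frac{u_1y}{w_1}\right)^{k}du_1\,dw_1\,dw_2 .$$
   Context: $(a)_n=a(a+1)\cdots(a+n-1)$, $(a)_0=1$. For $p>2\max\{k\}+1$ (with $\max\{k\}$ the largest degree $k$ considered), $q>-1$ and $\upsilon=1,2,\dots$, the finite bivariate M-Konhauser polynomials are $${}_{K}M_{k;\upsilon}^{(p,q)}(y,z)=(-1)^k\Gamma(k+q+1)\sum_{l=0}^{k}\sum_{s=0}^{k-l}\frac{(-k)_{l+s}(k+1-p)_l(-y)^l z^{\upsilon s}}{\Gamma(l+q+1)\Gamma(\upsilon s-p-q+1)\,l!\,s!}.$$ The contour integral $\int_{-\infty}^{0^+}$ (Hankel contour) is the one in $\frac1{\Gamma(x)}=\frac{1}{2\pi i}\int_{-\infty}^{0^+}e^{u}u^{-x}\,du$, $|\arg(u)|\le\pi$, and the Gamma function is $\Gamma(x)=\int_0^\infty e^{-u}u^{x-1}\,du$ for $\mathrm{Re}(x)>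0$.
   Formalization: Since p>2k+1 the u_1-integral diverges at 0, so it is read as Hadamard's finite part (the continued Gamma integral); at integer p, where Gamma(k+1-p) has a pole, the right-hand side is read as its limit through non-integer values of p. *)

(* Defs.v *)
From Stdlib Require Import Reals Factorial List.
From Coquelicot Require Import Coquelicot.
Open Scope R_scope.

Fixpoint poch (a : R) (n : nat) : R :=
  match n with
  | O => 1
  | S m => poch a m * (a + INR m)
  end.

Definition Gamma_euler (x : R) : R :=
  RInt_gen (V := R_CompleteNormedModule)
    (fun u => exp (- u) * Rpower u (x - 1)) (at_right 0) (Rbar_locally p_infty).

(* The least n with x + n > 0. *)
Definition Gamma_shift (x : R) : nat := Z.to_nat (up (- x)).

(* Gamma (x + n) = (x)_n Gamma x extends Gamma to the negative axis.  At a pole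
   x = 0, -1, -2, ... the symbol (x)_n is 0 and, as / 0 = 0, both Gamma x and
   / Gamma x are 0: the latter is the usual value of 1 / Gamma at a pole. *)
Definition Gamma (x : R) : R :=
  Gamma_euler (x + INR (Gamma_shift x)) / poch x (Gamma_shift x).

Definition konhauser_M (k v : nat) (p q : R) (y z : C) : C :=
  (RtoC ((-1) ^ k * Gamma (INR k + q + 1)) *
   sum_n (G := C_AbelianMonoid) (fun l : nat =>
     sum_n (G := C_AbelianMonoid) (fun s : nat =>
       RtoC (poch (- INR k) (l + s) * poch (INR k + 1 - p) l)
       * (- y) ^ l * z ^ (v * s)
       / RtoC (Gamma (INR l + q + 1) * Gamma (INR (v * s) - p - q + 1)
               * INR (fact l) * INR (fact s)))
     (k - l)) k)%C.

(* A point (r, t) of the Riemann surface of the logarithm, with modulus r and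
   argument t; its two preimages over a negative real are distinct. *)
Definition polar : Type := (R * R)%type.

Definition cis (t : R) : C := (cos t, sin t).

Definition pt (w : polar) : C := (RtoC (fst w) * cis (snd w))%C.

Definition ppow (w : polar) (a : R) : C :=
  (RtoC (Rpower (fst w) a) * cis (a * snd w))%C.

Definition cexp (x : C) : C := (RtoC (exp (Re x)) * cis (Im x))%C.

(* Hankel's contour: from -oo to -rho along arg = -PI, counterclockwise along
   the circle of radius rho, and back to -oo along arg = PI. *)
Definition on_hankel (rho : R) (w : polar) : Prop :=
  (fst w = rho /\ - PI <= snd w <= PI) \/
  (rho <= fst w /\ (snd w = - PI \/ snd w = PI)).

Definition is_hankel (rho : R) (f : polar -> C) (I : C) : Prop :=
  exists lower circle upper : C,
    is_RInt_gen (V := C_R_NormedModule) (fun r => f (r, (- PI)%R) * cis (- PI))%C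
      (at_point rho) (Rbar_locally p_infty) lower /\
    is_RInt (V := C_R_NormedModule)
      (fun t => f (rho, t) * (Ci * RtoC rho * cis t))%C (- PI) PI circle /\
    is_RInt_gen (V := C_R_NormedModule) (fun r => f (r, PI) * cis PI)%C
      (at_point rho) (Rbar_locally p_infty) upper /\
    I = (- lower + circle + upper)%C.

(* d * ln e + sum of c * e^(-a) over the pairs (a, c) of the list. *)
Definition singular_part (d : C) (cs : list (R * C)) (e : R) : C :=
  (d * RtoC (ln e) +
   fold_right (fun ac acc => snd ac * RtoC (Rpower e (- fst ac)) + acc)
     (RtoC 0) cs)%C.

(* Hadamard's finite part of the integral of g over (0, +oo): the constant term
   of the integral over (e, +oo) as e -> 0+, after removal of negative powers of
   e and of ln e.  It is the ordinary improper integral when that converges.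
   For e^(-u) u^(x-1) and real x other than 0, -1, -2, ... it is Gamma x, while
   for x < 0 the ordinary integral diverges. *)
Definition is_fp_integral (g : R -> C) (I : C) : Prop :=
  exists (J : R -> C) (d : C) (cs : list (R * C)),
    (forall e : R, 0 < e ->
       is_RInt_gen (V := C_R_NormedModule) g
         (at_point e) (Rbar_locally p_infty) (J e)) /\
    List.Forall (fun ac => 0 < fst ac) cs /\
    filterlim (fun e : R => (J e - singular_part d cs e)%C)
      (at_right 0) (locally I).

(* The iterated integral of f u1 w1 w2, innermost in u1 and outermost in w2. *)
Definition is_triple_integral (rho1 rho2 : R) (f : R -> polar -> polar -> C)
    (I : C) : Prop :=
  exists (F1 : polar -> polar -> C) (F2 : polar -> C),
    (forall w1 w2 : polar, on_hankel rho1 w1 -> on_hankel rho2 w2 ->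
       is_fp_integral (fun u1 => f u1 w1 w2) (F1 w1 w2)) /\
    (forall w2 : polar, on_hankel rho2 w2 ->
       is_hankel rho1 (fun w1 => F1 w1 w2) (F2 w2)) /\
    is_hankel rho2 F2 I.

Definition integrand (k v : nat) (p q : R) (y z : C)
    (u1 : R) (w1 w2 : polar) : C :=
  (cexp (- RtoC u1 + pt w1 + pt w2)
   * RtoC (Rpower u1 (INR k - p)) * ppow w1 (- q - 1) * ppow w2 (p + q - 1)
   * ((pt w2 ^ v - z ^ v) / pt w2 ^ v + RtoC u1 * y / pt w1) ^ k)%C.

Definition prefactor (k : nat) (p q : R) : C :=
  RtoC ((-1) ^ (k + 1) * Gamma (INR k + q + 1)
        / (4 * PI ^ 2 * Gamma (INR k + 1 - p))).

Definition is_integer (x : R) : Prop := exists n : Z, x = IZR n.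

(* Main.v *)
Require Import Defs.
From Stdlib Require Import Reals ZArith Lra Lia Classical_Prop FunctionalExtensionality.
From Coquelicot Require Import Coquelicot.
From Stdlib Require Import List.
Open Scope R_scope.

(** Expand the kth power in the integrand by the trinomial theorem, in the form

      (1 - Z + Y)^k = sum over l + s <= k of (-k)_(l+s) / (l! s!) (-Y)^l Z^s

    with Y = u_1 y / w_1 and Z = z^v / w_2^v.  The term of index (l, s) is a
    constant times the product of a function of u_1, a function of w_1 and a
    function of w_2, so the triple integral is a finite sum of products of three
    one-variable integrals:

    - the finite part of the integral of e^(-u) u^(k+l-p), which is
      Gamma (k + 1 - p + l) = (k + 1 - p)_l Gamma (k + 1 - p);
    - Hankel's integral of e^w w^(-(l+q+1)), which is 2 pi i / Gamma (l + q + 1);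
    - Hankel's integral of e^w w^(-(v s-p-q+1)), which is
      2 pi i / Gamma (v s - p - q + 1).

    The two factors 2 pi i give the -4 pi^2 of the prefactor, and the sum becomes
    the definition of the polynomial ([prefactor_triple_value]).  At an integer p
    the identity holds at all other nearby exponents, and the polynomial is
    continuous in p because 1 / Gamma is continuous on the whole line
    ([continuous_konhauser_M]).

    The weight of the proof lies in the two integrals.

    Finite part ([upper_gamma_finite_part]).  Let U (x, e) be the integral of
    e^(-u) u^(x-1) over (e, oo).  Integration by parts gives
    U (x + 1, e) = x U (x, e) + e^(-e) e^x.  The boundary term is a combination of
    powers of e up to o(1), by the Taylor expansion of e^(-e), and no exponent
    vanishes because x is not an integer.  So the constant term of U (x, e)
    satisfies the functional equation of Gamma, and for x > 0 it is Euler's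
    integral.

    Hankel's formula ([is_hankel_term], [hankel_sum_eq]).  In polar coordinates
    the integral of e^w w^(-a) is i times the real quantity

      H (a) = rho^(1-a) D (1 - a, rho) + 2 sin (pi a) U (1 - a, rho),
      D (b, rho) = integral over (-pi, pi) of
                     e^(rho cos t) cos (rho sin t + b t) dt.

    Differentiation under the integral sign shows that H does not depend on rho,
    and integration by parts gives H (a - 1) = (a - 1) H (a).  As 1 / Gamma
    satisfies the same recurrence, it is enough to treat 0 < a <= 1, where rho
    may tend to 0: H (1) = 2 pi, and H (a) = 2 sin (pi a) Gamma (1 - a) if a < 1.
    What remains is the reflection formula.

    Reflection formula ([Gamma_euler_reflection]).  Put
    r_n = I_n (x) / I_n (0), where I_n (x) is the integral over (0, pi/2) of
    cos (2 x t) cos^(2n) t, and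
    g_n = Gamma (n + 1 + x) Gamma (n + 1 - x) / Gamma (n + 1)^2.
    Passing from n to n + 1 multiplies g_n by 1 - x^2 / (n + 1)^2 and divides r_n
    by the same number, so g_n r_n does not depend on n.  For n = 0 it is
    Gamma (x) Gamma (1 - x) sin (pi x) / pi, and both factors tend to 1: r_n by an
    elementary estimate, g_n by Gautschi's inequality
    Gamma (s + t) <= s^t Gamma (s). *)

(** * Limits of real functions and improper integrals *)

Lemma Rpower_ge0 (a b : R) : 0 <= Rpower a b.
Proof. apply Rlt_le, exp_pos. Qed.

Lemma Rpower_gt0 (a b : R) : 0 < Rpower a b.
Proof. apply exp_pos. Qed.

Lemma filter_infty_ge (e : R) : Rbar_locally p_infty (fun b => e <= b).
Proof. exists e. intros b Hb. lra. Qed.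

Lemma lim_plus {T} (F : (T -> Prop) -> Prop) {FF : Filter F} (f g : T -> R) (a b : R) :
  filterlim f F (locally a) -> filterlim g F (locally b) ->
  filterlim (fun t => f t + g t) F (locally (a + b)).
Proof.
  intros Hf Hg.
  exact (filterlim_comp_2 f g _ Hf Hg (filterlim_plus (V := R_NormedModule) a b)).
Qed.

Lemma lim_mult {T} (F : (T -> Prop) -> Prop) {FF : Filter F} (f g : T -> R) (a b : R) :
  filterlim f F (locally a) -> filterlim g F (locally b) ->
  filterlim (fun t => f t * g t) F (locally (a * b)).
Proof.
  intros Hf Hg.
  exact (filterlim_comp_2 f g _ Hf Hg (filterlim_mult (K := R_AbsRing) a b)).
Qed.

Lemma lim_scal {T} (F : (T -> Prop) -> Prop) {FF : Filter F} (c : R) (f : T -> R) (a : R) :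
  filterlim f F (locally a) -> filterlim (fun t => c * f t) F (locally (c * a)).
Proof. intros Hf. apply lim_mult; auto. apply filterlim_const. Qed.

Lemma lim_eq {T} (F : (T -> Prop) -> Prop) (f : T -> R) (a b : R) :
  filterlim f F (locally a) -> a = b -> filterlim f F (locally b).
Proof. now intros H <-. Qed.

Lemma monotone_limit_infty (F : R -> R) (e M : R) :
  (forall b c, e <= b -> b <= c -> F b <= F c) ->
  (forall b, e <= b -> F b <= M) ->
  exists l : R, filterlim F (Rbar_locally p_infty) (locally l).
Proof.
  intros Hmono Hbd.
  destruct (completeness (fun r => exists b, e <= b /\ r = F b)) as [l [Hub Hlub]].
  - exists M. intros r [b [Hb ->]]. auto.
  - exists (F e), e. split; [lra | reflexivity].
  - exists l. apply filterlim_locally. intros eps.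
    assert (Hex : exists b, e <= b /\ l - eps < F b).
    { apply NNPP. intros Hno.
      assert (l <= l - eps).
      { apply Hlub. intros r [b [Hb ->]]. apply Rnot_lt_le. intros Hlt.
        apply Hno. exists b. split; assumption. }
      pose proof (cond_pos eps). lra. }
    destruct Hex as [b [Hb Hlt]].
    exists b. intros c Hc.
    assert (F b <= F c) by (apply Hmono; lra).
    assert (F c <= l) by (apply Hub; exists c; split; [lra | reflexivity]).
    change (Rabs (F c - l) < eps). apply Rabs_def1; lra.
Qed.

Lemma monotone_limit_zero (F : R -> R) (M : R) :
  (forall b c, 0 < b -> b <= c -> F c <= F b) ->
  (forall b, 0 < b -> F b <= M) ->
  exists l : R, filterlim F (at_right 0) (locally l).
Proof.
  intros Hmono Hbd.
  destruct (monotone_limit_infty (fun b => F (/ b)) 1 M) as [l Hl].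
  - intros b c Hb Hbc. apply Hmono. apply Rinv_0_lt_compat; lra.
    apply Rinv_le_contravar; lra.
  - intros b Hb. apply Hbd. apply Rinv_0_lt_compat; lra.
  - exists l. apply filterlim_ext_loc with (fun b => F (/ / b)).
    + exists (mkposreal 1 Rlt_0_1). intros b _ Hb. now rewrite Rinv_inv.
    + apply (filterlim_comp _ _ _ Rinv (fun b => F (/ b)) _ (Rbar_locally p_infty)).
      apply filterlim_Rinv_0_right. exact Hl.
Qed.

(** The improper integral is defined by a filter on pairs of endpoints; when the
    lower endpoint is fixed it is an ordinary limit of proper integrals. *)
Lemma is_RInt_gen_infty_iff (f : R -> R) (e l : R) :
  (forall b, e <= b -> ex_RInt f e b) ->
  is_RInt_gen f (at_point e) (Rbar_locally p_infty) l <->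
  filterlim (fun b => RInt f e b) (Rbar_locally p_infty) (locally l).
Proof.
  intros Hex. split.
  - intros H P HP. destruct (H P HP) as [Q S HQ HS HQS].
    unfold filtermap. apply filter_imp with (2 := HS). intros b Hb.
    destruct (HQS e b HQ Hb) as [v [Hv Pv]]. simpl in Hv.
    now rewrite (is_RInt_unique _ _ _ _ Hv).
  - intros H P HP. specialize (H P HP). unfold filtermap in H.
    exists (fun a => a = e) (fun b => e <= b /\ P (RInt f e b)).
    + reflexivity.
    + apply filter_and. apply filter_infty_ge. exact H.
    + intros a b -> [Hb Hp]. exists (RInt f e b). split; auto. simpl.
      apply (@RInt_correct R_CompleteNormedModule). auto.
Qed.

Lemma is_RInt_gen_infty_le (f g : R -> R) (e lf lg : R) :
  (forall b, e <= b -> ex_RInt f e b) ->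
  (forall b, e <= b -> ex_RInt g e b) ->
  (forall u, e < u -> f u <= g u) ->
  is_RInt_gen f (at_point e) (Rbar_locally p_infty) lf ->
  is_RInt_gen g (at_point e) (Rbar_locally p_infty) lg ->
  lf <= lg.
Proof.
  intros Hf Hg Hle If Ig.
  apply is_RInt_gen_infty_iff in If; auto.
  apply is_RInt_gen_infty_iff in Ig; auto.
  assert (Rbar_le lf lg); [|assumption].
  apply (filterlim_le (F := Rbar_locally p_infty) _ _ lf lg) with (2 := If) (3 := Ig).
  apply filter_imp with (2 := filter_infty_ge e). intros b Hb.
  apply RInt_le; auto. intros u Hu. apply Hle. lra.
Qed.

(** The antiderivative of the dominating function also yields the explicit bound
    on the integral, which for Euler's integral has to be uniform in [e]. *)
Lemma ex_RInt_gen_infty_dom (f g G : R -> R) (e M : R) :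
  (forall b, e <= b -> ex_RInt f e b) ->
  (forall u, e <= u -> 0 <= f u <= g u) ->
  (forall u, e <= u -> is_derive G u (g u)) ->
  (forall u, e <= u -> continuous g u) ->
  (forall u, e <= u -> G u <= M) ->
  exists l, is_RInt_gen f (at_point e) (Rbar_locally p_infty) l /\ l <= M - G e.
Proof.
  intros Hf Hfg HG Hg HM.
  assert (Hg' : forall b, e <= b -> is_RInt g e b (G b - G e)).
  { intros b Hb. apply (is_RInt_derive G g); rewrite Rmin_left, Rmax_right by lra;
    intros u Hu; [apply HG | apply Hg]; lra. }
  assert (Hbd : forall b, e <= b -> RInt f e b <= M - G e).
  { intros b Hb. apply Rle_trans with (RInt g e b).
    - apply RInt_le; auto. eexists; apply Hg'; auto. intros u Hu. apply Hfg; lra.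
    - rewrite (is_RInt_unique _ _ _ _ (Hg' b Hb)). specialize (HM b Hb). lra. }
  destruct (monotone_limit_infty (fun b => RInt f e b) e (M - G e)) as [l Hl]; auto.
  - intros b c Hb Hbc.
    assert (Hbc' : ex_RInt f b c).
    { apply (ex_RInt_Chasles_2 f e); [lra | apply Hf; lra]. }
    rewrite <- (RInt_Chasles f e b c); auto.
    change (RInt f e b <= RInt f e b + RInt f b c).
    assert (0 <= RInt f b c); [|lra].
    apply RInt_ge_0; auto. intros u Hu. apply Hfg. lra.
  - exists l. split. apply is_RInt_gen_infty_iff; auto.
    assert (Rbar_le l (M - G e)); [|assumption].
    apply (filterlim_le (F := Rbar_locally p_infty) (fun b => RInt f e b) (fun _ => M - G e) l (M - G e)); auto.
    apply filter_imp with (2 := filter_infty_ge e). auto.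
    apply filterlim_const.
Qed.

(** * The incomplete Gamma function *)

Definition gamma_density (x u : R) : R := exp (- u) * Rpower u (x - 1).

Definition upper_gamma (x e : R) : R :=
  RInt_gen (V := R_CompleteNormedModule) (gamma_density x) (at_point e) (Rbar_locally p_infty).

Lemma gamma_density_ge0 (x u : R) : 0 <= gamma_density x u.
Proof. apply Rmult_le_pos. apply Rlt_le, exp_pos. apply Rpower_ge0. Qed.

Lemma is_derive_Rpower (x u : R) : 0 < u ->
  is_derive (fun t => Rpower t x) u (x * Rpower u (x - 1)).
Proof. intros Hu. apply is_derive_Reals, derivable_pt_lim_power, Hu. Qed.

Lemma continuous_Rpower (x u : R) : 0 < u -> continuous (fun t => Rpower t x) u.
Proof.
  intros Hu. apply (ex_derive_continuous (fun t : R => Rpower t x)).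
  eexists. now apply is_derive_Rpower.
Qed.

Lemma continuous_gamma_density (x u : R) : 0 < u -> continuous (gamma_density x) u.
Proof.
  intros Hu. unfold gamma_density.
  apply (continuous_mult (fun t => exp (- t)) (fun t => Rpower t (x - 1))).
  - apply (ex_derive_continuous (fun t : R => exp (- t))). auto_derive. exact I.
  - now apply continuous_Rpower.
Qed.

Lemma ex_RInt_gamma_density (x a b : R) : 0 < a -> 0 < b ->
  ex_RInt (gamma_density x) a b.
Proof.
  intros Ha Hb. apply (@ex_RInt_continuous R_CompleteNormedModule).
  intros u Hu. apply continuous_gamma_density.
  assert (0 < Rmin a b) by now apply Rmin_case. lra.
Qed.

(** The bounded increasing function (u / (1 + u))^x has derivative
    x u^(x-1) (1 + u)^(-x-1).  It dominates e^(-u) u^(x-1), up to a constant, near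
    0 and at infinity at once. *)
Lemma Rpower_frac_le1 (x u : R) : 0 < x -> 0 < u -> Rpower (u / (1 + u)) x <= 1.
Proof.
  intros Hx Hu. replace 1 with (Rpower 1 x) at 2.
  - apply Rle_Rpower_l; [lra|]. split. apply Rdiv_lt_0_compat; lra.
    apply Rmult_le_reg_r with (1 + u); [lra|]. field_simplify; lra.
  - unfold Rpower. now rewrite ln_1, Rmult_0_r, exp_0.
Qed.

Lemma ln_le_sub1 (x : R) : 0 < x -> ln x <= x - 1.
Proof.
  intros Hx. pose proof (exp_ineq1_le (ln x)). rewrite exp_ln in H; lra.
Qed.

Lemma exp_le_compat (x y : R) : x <= y -> exp x <= exp y.
Proof. intros [H| ->]. apply Rlt_le, exp_increasing, H. apply Rle_refl. Qed.

(** The maximum over u of e^(-u) (1 + u)^(x+1), attained at u = x, divided by the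
    factor x of the derivative of (u / (1 + u))^x. *)
Definition gamma_bound (x : R) : R := exp ((x + 1) * ln (x + 1) - x) / x.

(** Taking logarithms, the claim is the concavity bound ln t <= t - 1 at
    t = (1 + u) / (x + 1). *)
Lemma gamma_density_dom (x u : R) : 0 < x -> 0 < u ->
  gamma_density x u <= gamma_bound x * (x * Rpower (u / (1 + u)) (x - 1) / (1 + u) ^ 2).
Proof.
  intros Hx Hu.
  replace (gamma_bound x * (x * Rpower (u / (1 + u)) (x - 1) / (1 + u) ^ 2))
    with (exp ((x + 1) * ln (x + 1) - x + (x - 1) * (ln u - ln (1 + u)) - 2 * ln (1 + u))).
  - unfold gamma_density, Rpower. rewrite <- exp_plus. apply exp_le_compat.
    assert (H : ln ((1 + u) / (x + 1)) <= (1 + u) / (x + 1) - 1)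
      by (apply ln_le_sub1, Rdiv_lt_0_compat; lra).
    rewrite ln_div in H by lra.
    apply (Rmult_le_compat_l (x + 1)) in H; [|lra].
    replace ((x + 1) * ((1 + u) / (x + 1) - 1)) with (u - x) in H by (field; lra).
    lra.
  - unfold gamma_bound, Rpower.
    rewrite ln_div by lra. unfold Rminus at 1. rewrite !exp_plus.
    replace (exp (- (2 * ln (1 + u)))) with (/ (1 + u) ^ 2).
    + field. split; lra.
    + rewrite exp_Ropp. f_equal. replace (2 * ln (1 + u)) with (INR 2 * ln (1 + u)) by (simpl; lra).
      change (exp (INR 2 * ln (1 + u))) with (Rpower (1 + u) (INR 2)).
      now rewrite Rpower_pow by lra.
Qed.

Lemma is_derive_Rpower_frac (x u : R) : 0 < u ->
  is_derive (fun t => Rpower (t / (1 + t)) x) u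
    (x * Rpower (u / (1 + u)) (x - 1) / (1 + u) ^ 2).
Proof.
  intros Hu.
  assert (Hf : 0 < u / (1 + u)) by (apply Rdiv_lt_0_compat; lra).
  evar_last.
  apply (is_derive_comp (fun t => Rpower t x) (fun t => t / (1 + t)) u).
  apply is_derive_Rpower; auto.
  auto_derive. lra. reflexivity.
  unfold scal; simpl; unfold mult; simpl. field. lra.
Qed.

(** For x <= 0 the factor u^(x-1) is largest at the lower endpoint and e^(-u)
    alone ensures convergence; the bound in the case x > 0 does not depend on
    [e], so that [e] may tend to 0. *)
Lemma upper_gamma_ex (x e : R) : 0 < e ->
  exists l, is_RInt_gen (gamma_density x) (at_point e) (Rbar_locally p_infty) l /\
    (0 < x -> l <= gamma_bound x).
Proof.
  intros He. destruct (Rlt_dec 0 x) as [Hx|Hx].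
  - destruct (ex_RInt_gen_infty_dom (gamma_density x)
      (fun u => gamma_bound x * (x * Rpower (u / (1 + u)) (x - 1) / (1 + u) ^ 2))
      (fun u => gamma_bound x * Rpower (u / (1 + u)) x) e (gamma_bound x)) as [l [Hl Hle]].
    + intros b Hb. apply ex_RInt_gamma_density; lra.
    + intros u Hu. split. apply gamma_density_ge0. apply gamma_density_dom; lra.
    + intros u Hu. apply is_derive_scal. apply is_derive_Rpower_frac. lra.
    + intros u Hu.
      apply (continuous_scal_r (gamma_bound x) (fun u => x * Rpower (u / (1 + u)) (x - 1) / (1 + u) ^ 2)).
      apply (continuous_mult (fun u => x * Rpower (u / (1 + u)) (x - 1)) (fun u => / (1 + u) ^ 2)).
      * apply (continuous_scal_r x (fun u => Rpower (u / (1 + u)) (x - 1))).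
        apply (ex_derive_continuous (fun u : R => Rpower (u / (1 + u)) (x - 1))).
        eexists. apply is_derive_Rpower_frac. lra.
      * apply (ex_derive_continuous (fun u : R => / (1 + u) ^ 2)). auto_derive. nra.
    + intros u Hu. rewrite <- (Rmult_1_r (gamma_bound x)) at 2.
      apply Rmult_le_compat_l. apply Rmult_le_pos. apply Rlt_le, exp_pos.
      apply Rlt_le, Rinv_0_lt_compat, Hx. apply Rpower_frac_le1; lra.
    + exists l. split; auto. intros _. apply Rle_trans with (1 := Hle).
      assert (0 <= gamma_bound x * Rpower (e / (1 + e)) x); [|lra].
      apply Rmult_le_pos. apply Rmult_le_pos. apply Rlt_le, exp_pos.
      apply Rlt_le, Rinv_0_lt_compat, Hx. apply Rpower_ge0.
  - destruct (ex_RInt_gen_infty_dom (gamma_density x)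
      (fun u => Rpower e (x - 1) * exp (- u))
      (fun u => - (Rpower e (x - 1) * exp (- u))) e 0) as [l [Hl Hle]].
    + intros b Hb. apply ex_RInt_gamma_density; lra.
    + intros u Hu. split. apply gamma_density_ge0.
      unfold gamma_density. rewrite Rmult_comm. apply Rmult_le_compat_r. apply Rlt_le, exp_pos.
      replace (x - 1) with (- (1 - x)) by ring. rewrite !Rpower_Ropp.
      apply Rinv_le_contravar. apply Rpower_gt0. apply Rle_Rpower_l; lra.
    + intros u Hu. auto_derive. exact I. ring.
    + intros u Hu. apply (ex_derive_continuous (fun u : R => Rpower e (x - 1) * exp (- u))).
      auto_derive. exact I.
    + intros u Hu. assert (0 < Rpower e (x - 1) * exp (- u)); [|lra].
      apply Rmult_lt_0_compat. apply Rpower_gt0. apply exp_pos.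
    + exists l. split; auto. lra.
Qed.

Lemma upper_gamma_correct (x e : R) : 0 < e ->
  is_RInt_gen (gamma_density x) (at_point e) (Rbar_locally p_infty) (upper_gamma x e).
Proof.
  intros He. apply (@RInt_gen_correct R_CompleteNormedModule _ _ _ _ (gamma_density x)). destruct (upper_gamma_ex x e He) as [l [Hl _]].
  now exists l.
Qed.

Lemma is_RInt_gen_infty_unique (f : R -> R) (e l1 l2 : R) :
  is_RInt_gen f (at_point e) (Rbar_locally p_infty) l1 ->
  is_RInt_gen f (at_point e) (Rbar_locally p_infty) l2 -> l1 = l2.
Proof.
  intros H1 H2.
  apply (@is_RInt_gen_unique R_CompleteNormedModule _ _ _ _) in H1.
  apply (@is_RInt_gen_unique R_CompleteNormedModule _ _ _ _) in H2.
  congruence.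
Qed.

Lemma upper_gamma_le_bound (x e : R) : 0 < x -> 0 < e -> upper_gamma x e <= gamma_bound x.
Proof.
  intros Hx He. destruct (upper_gamma_ex x e He) as [l [Hl Hle]].
  rewrite (is_RInt_gen_infty_unique _ _ _ _ (upper_gamma_correct x e He) Hl). auto.
Qed.

Lemma upper_gamma_split (x a b : R) : 0 < a -> 0 < b ->
  upper_gamma x a = RInt (gamma_density x) a b + upper_gamma x b.
Proof.
  intros Ha Hb. apply (is_RInt_gen_infty_unique (gamma_density x) a).
  now apply upper_gamma_correct.
  apply (is_RInt_gen_Chasles (V := R_NormedModule)) with b.
  - apply is_RInt_gen_at_point. apply (@RInt_correct R_CompleteNormedModule).
    now apply ex_RInt_gamma_density.
  - now apply upper_gamma_correct.
Qed.

Lemma upper_gamma_lim_ex (x : R) : 0 < x ->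
  exists l : R, filterlim (upper_gamma x) (at_right 0) (locally l).
Proof.
  intros Hx. apply monotone_limit_zero with (gamma_bound x).
  - intros b c Hb Hbc. rewrite (upper_gamma_split x b c) by lra.
    assert (0 <= RInt (gamma_density x) b c); [|lra].
    apply RInt_ge_0; auto. apply ex_RInt_gamma_density; lra.
    intros; apply gamma_density_ge0.
  - intros b Hb. now apply upper_gamma_le_bound.
Qed.

Lemma at_right_pos (P : R -> Prop) : (forall e, 0 < e -> P e) -> at_right 0 P.
Proof. intros H. exists (mkposreal 1 Rlt_0_1). intros e _ He. auto. Qed.

(** Euler's integral, improper at both ends, is split at 1. *)
Lemma upper_gamma_lim (x : R) : 0 < x ->
  filterlim (upper_gamma x) (at_right 0) (locally (Gamma_euler x)).
Proof.
  intros Hx. destruct (upper_gamma_lim_ex x Hx) as [l Hl].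
  assert (H : is_RInt_gen (gamma_density x) (at_right 0) (Rbar_locally p_infty) l).
  { replace l with (plus (l - upper_gamma x 1) (upper_gamma x 1))
      by (unfold plus; simpl; ring).
    apply (is_RInt_gen_Chasles (V := R_NormedModule)) with 1.
    2: apply upper_gamma_correct; lra.
    assert (Hl' : filterlim (fun e => RInt (gamma_density x) e 1) (at_right 0)
      (locally (l - upper_gamma x 1))).
    { apply filterlim_ext_loc with (fun e => upper_gamma x e - upper_gamma x 1).
      - apply at_right_pos. intros e He. rewrite (upper_gamma_split x e 1) by lra. ring.
      - apply (lim_plus (at_right 0)). exact Hl. apply filterlim_const. }
    intros P HP. specialize (Hl' P HP). unfold filtermap in Hl'.
    exists (fun a => 0 < a /\ P (RInt (gamma_density x) a 1)) (fun b => b = 1).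
    - apply filter_and; auto. now apply at_right_pos.
    - reflexivity.
    - intros a b [Ha Hp] ->. exists (RInt (gamma_density x) a 1). split; auto.
      apply (@RInt_correct R_CompleteNormedModule). apply ex_RInt_gamma_density; simpl; lra. }
  replace (Gamma_euler x) with l; auto. symmetry.
  unfold Gamma_euler. apply (@is_RInt_gen_unique R_CompleteNormedModule _ _ _ _). exact H.
Qed.

(** As x ln b <= b / 2 + const, the product is below a multiple of e^(-b/2). *)
Lemma exp_Rpower_infty (x : R) :
  filterlim (fun b => exp (- b) * Rpower b x) (Rbar_locally p_infty) (locally 0).
Proof.
  (* so that |x| / l < 1 / 2 in the bound |x| ln (b / l) <= |x| (b / l - 1) *)
  set (l := 2 * Rabs x + 1). pose proof (Rabs_pos x) as Hx0.
  apply filterlim_locally. intros eps.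
  exists (Rmax 1 (2 * (Rabs x * ln l - ln eps))). intros b Hb.
  assert (Hb1 : 1 < b) by (eapply Rle_lt_trans; [apply Rmax_l | exact Hb]).
  assert (Hb2 : 2 * (Rabs x * ln l - ln eps) < b) by (eapply Rle_lt_trans; [apply Rmax_r | exact Hb]).
  change (Rabs (exp (- b) * Rpower b x - 0) < eps).
  rewrite Rminus_0_r, Rabs_pos_eq.
  2: { apply Rmult_le_pos. apply Rlt_le, exp_pos. apply Rpower_ge0. }
  unfold Rpower. rewrite <- exp_plus. rewrite <- (exp_ln eps) by apply cond_pos.
  apply exp_increasing.
  assert (Hln : 0 <= ln b) by (rewrite <- ln_1; apply Rlt_le, ln_increasing; lra).
  assert (H : ln (b / l) <= b / l - 1) by (apply ln_le_sub1, Rdiv_lt_0_compat; unfold l; lra).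
  rewrite ln_div in H by (unfold l; lra).
  assert (H1 : x * ln b <= Rabs x * ln b) by (apply Rmult_le_compat_r; [lra | apply RRle_abs]).
  assert (H2 : Rabs x * (ln b - ln l) <= Rabs x * (b / l - 1)) by (apply Rmult_le_compat_l; lra).
  assert (H3 : Rabs x * (b / l - 1) <= b / 2).
  { apply Rmult_le_reg_r with l; [unfold l; lra|].
    replace (Rabs x * (b / l - 1) * l) with (Rabs x * (b - l)) by (field; unfold l; lra).
    unfold l. nra. }
  lra.
Qed.

Lemma gamma_density_S (x u : R) : gamma_density (x + 1) u = exp (- u) * Rpower u x.
Proof. unfold gamma_density. do 2 f_equal. ring. Qed.

(** Integration by parts: -e^(-u) u^x is an antiderivative of
    e^(-u) u^x - x e^(-u) u^(x-1) and vanishes at infinity. *)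
Lemma upper_gamma_rec (x e : R) : 0 < e ->
  upper_gamma (x + 1) e = x * upper_gamma x e + exp (- e) * Rpower e x.
Proof.
  intros He.
  assert (Hd : forall u, 0 < u -> is_derive (fun u => - (exp (- u) * Rpower u x)) u
     (gamma_density (x + 1) u - x * gamma_density x u)).
  { intros u Hu. evar_last. apply (is_derive_opp (fun u : R => exp (- u) * Rpower u x)).
    apply (is_derive_mult (fun u => exp (- u)) (fun u => Rpower u x)).
    auto_derive. exact I. reflexivity. now apply is_derive_Rpower. apply Rmult_comm.
    rewrite gamma_density_S. unfold gamma_density, plus, opp, mult; simpl. unfold mult; simpl. ring. }
  assert (HI : is_RInt_gen (fun u => gamma_density (x + 1) u - x * gamma_density x u)
    (at_point e) (Rbar_locally p_infty) (upper_gamma (x + 1) e - x * upper_gamma x e)).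
  { apply (is_RInt_gen_minus (V := R_NormedModule) (gamma_density (x + 1)) (fun u => x * gamma_density x u)).
    now apply upper_gamma_correct.
    apply (is_RInt_gen_scal (V := R_NormedModule) (gamma_density x)).
    now apply upper_gamma_correct. }
  assert (Hb : forall b, e <= b -> is_RInt (fun u => gamma_density (x + 1) u - x * gamma_density x u) e b
     (- (exp (- b) * Rpower b x) - - (exp (- e) * Rpower e x))).
  { intros b Hb. apply (is_RInt_derive (fun u => - (exp (- u) * Rpower u x))).
    - rewrite Rmin_left, Rmax_right by lra. intros u Hu. apply Hd. lra.
    - rewrite Rmin_left, Rmax_right by lra. intros u Hu.
      apply (continuous_minus (gamma_density (x + 1)) (fun u => x * gamma_density x u)).
      apply continuous_gamma_density; lra.
      apply (continuous_scal_r x (gamma_density x)). apply continuous_gamma_density; lra. }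
  apply is_RInt_gen_infty_iff in HI.
  2: { intros b Hb'. eexists. now apply Hb. }
  assert (HL : filterlim (fun b => RInt (fun u => gamma_density (x + 1) u - x * gamma_density x u) e b)
    (Rbar_locally p_infty) (locally (exp (- e) * Rpower e x))).
  { apply filterlim_ext_loc with (fun b => exp (- e) * Rpower e x + - 1 * (exp (- b) * Rpower b x)).
    - apply filter_imp with (2 := filter_infty_ge e). intros b Hb'.
      rewrite (is_RInt_unique _ _ _ _ (Hb b Hb')). ring.
    - replace (exp (- e) * Rpower e x) with (exp (- e) * Rpower e x + -1 * 0) at 1 by ring.
      apply (lim_plus (Rbar_locally p_infty)). apply filterlim_const.
      apply (lim_scal (Rbar_locally p_infty)). apply exp_Rpower_infty. }
  pose proof (filterlim_locally_unique _ _ _ HI HL). lra.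
Qed.

Lemma upper_gamma_1 (e : R) : 0 < e -> upper_gamma 1 e = exp (- e).
Proof.
  intros He. replace 1 with (0 + 1) by ring. rewrite upper_gamma_rec, Rpower_O by auto. ring.
Qed.

Lemma Rpower_lim_0 (x : R) : 0 < x ->
  filterlim (fun e => Rpower e x) (at_right 0) (locally 0).
Proof.
  intros Hx. apply filterlim_locally. intros eps.
  exists (mkposreal (Rpower eps (/ x)) (Rpower_gt0 _ _)). intros e He He0.
  change (Rabs (e - 0) < Rpower eps (/ x)) in He.
  rewrite Rminus_0_r, Rabs_pos_eq in He by lra.
  change (Rabs (Rpower e x - 0) < eps).
  rewrite Rminus_0_r, Rabs_pos_eq by apply Rpower_ge0.
  replace (pos eps) with (Rpower (Rpower eps (/ x)) x).
  - apply Rlt_Rpower_l; auto.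
  - rewrite Rpower_mult, Rinv_l, Rpower_1; auto. apply cond_pos. lra.
Qed.

Lemma at_right_continuous (f : R -> R) (x : R) : continuous f x ->
  filterlim f (at_right x) (locally (f x)).
Proof.
  intros H. apply filterlim_filter_le_1 with (2 := H).
  intros P [d HP]. exists d. intros y Hy _. now apply HP.
Qed.

Lemma exp_opp_lim_0 : filterlim (fun e => exp (- e)) (at_right 0) (locally 1).
Proof.
  replace 1 with (exp (- 0)) by (rewrite Ropp_0; apply exp_0).
  apply (at_right_continuous (fun e => exp (- e))).
  apply (ex_derive_continuous (fun e : R => exp (- e))). auto_derive. exact I.
Qed.

Lemma at_right_lim_unique (f g : R -> R) (a b : R) :
  (forall e, 0 < e -> f e = g e) ->
  filterlim f (at_right 0) (locally a) -> filterlim g (at_right 0) (locally b) -> a = b.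
Proof.
  intros He Hf Hg. apply (filterlim_locally_unique (F := at_right 0) g); auto.
  apply filterlim_ext_loc with (2 := Hf). now apply at_right_pos.
Qed.

Lemma at_right_lim_le (f g : R -> R) (a b : R) :
  (forall e, 0 < e < 1 -> f e <= g e) ->
  filterlim f (at_right 0) (locally a) -> filterlim g (at_right 0) (locally b) -> a <= b.
Proof.
  intros He Hf Hg.
  assert (Rbar_le a b); [|assumption].
  apply (filterlim_le (F := at_right 0) f g a b); auto.
  exists (mkposreal 1 Rlt_0_1). intros e Hb H. apply He.
  change (Rabs (e - 0) < 1) in Hb. apply Rabs_def2 in Hb. lra.
Qed.

(** * Euler's integral for positive arguments *)

Lemma Gamma_euler_rec (x : R) : 0 < x -> Gamma_euler (x + 1) = x * Gamma_euler x.
Proof.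
  intros Hx.
  apply (at_right_lim_unique (upper_gamma (x + 1))
    (fun e => x * upper_gamma x e + exp (- e) * Rpower e x)).
  - intros e He. now apply upper_gamma_rec.
  - apply upper_gamma_lim; lra.
  - replace (x * Gamma_euler x) with (x * Gamma_euler x + 1 * 0) by ring.
    apply (lim_plus (at_right 0)).
    + apply (lim_scal (at_right 0)). now apply upper_gamma_lim.
    + apply (lim_mult (at_right 0)). apply exp_opp_lim_0. now apply Rpower_lim_0.
Qed.

Lemma Gamma_euler_1 : Gamma_euler 1 = 1.
Proof.
  apply (at_right_lim_unique (upper_gamma 1) (fun e => exp (- e))).
  - apply upper_gamma_1.
  - apply upper_gamma_lim; lra.
  - apply exp_opp_lim_0.
Qed.

(** Convexity of Gamma and Gautschi's inequality both come from integrating a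
    pointwise inequality between powers of [u]; this is their common form. *)
Lemma upper_gamma_comb_le (x y z A B e : R) : 0 < e ->
  (forall u, e < u -> Rpower u (x - 1) <= A * Rpower u (y - 1) + B * Rpower u (z - 1)) ->
  upper_gamma x e <= A * upper_gamma y e + B * upper_gamma z e.
Proof.
  intros He H.
  assert (Hex : forall b, e <= b -> ex_RInt (fun u => A * gamma_density y u + B * gamma_density z u) e b).
  { intros b Hb. apply (@ex_RInt_plus R_NormedModule).
    apply (@ex_RInt_scal R_NormedModule (gamma_density y)). apply ex_RInt_gamma_density; lra.
    apply (@ex_RInt_scal R_NormedModule (gamma_density z)). apply ex_RInt_gamma_density; lra. }
  apply (is_RInt_gen_infty_le (gamma_density x)
    (fun u => A * gamma_density y u + B * gamma_density z u) e); auto.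
  - intros b Hb. apply ex_RInt_gamma_density; lra.
  - intros u Hu. unfold gamma_density.
    replace (A * (exp (- u) * Rpower u (y - 1)) + B * (exp (- u) * Rpower u (z - 1)))
      with (exp (- u) * (A * Rpower u (y - 1) + B * Rpower u (z - 1))) by ring.
    apply Rmult_le_compat_l; auto. apply Rlt_le, exp_pos.
  - now apply upper_gamma_correct.
  - apply (is_RInt_gen_plus (V := R_NormedModule));
    apply (is_RInt_gen_scal (V := R_NormedModule)); now apply upper_gamma_correct.
Qed.

Lemma Gamma_euler_comb_le (x y z A B : R) : 0 < x -> 0 < y -> 0 < z ->
  (forall u, 0 < u -> Rpower u (x - 1) <= A * Rpower u (y - 1) + B * Rpower u (z - 1)) ->
  Gamma_euler x <= A * Gamma_euler y + B * Gamma_euler z.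
Proof.
  intros Hx Hy Hz H.
  apply (at_right_lim_le (upper_gamma x) (fun e => A * upper_gamma y e + B * upper_gamma z e)).
  - intros e He. apply upper_gamma_comb_le; [lra|]. intros u Hu. apply H. lra.
  - now apply upper_gamma_lim.
  - apply (lim_plus (at_right 0)); apply (lim_scal (at_right 0)); now apply upper_gamma_lim.
Qed.

Lemma upper_gamma_ge0 (x e : R) : 0 < e -> 0 <= upper_gamma x e.
Proof.
  intros He. apply (is_RInt_gen_infty_le (fun _ => 0) (gamma_density x) e).
  - intros. apply ex_RInt_const.
  - intros. apply ex_RInt_gamma_density; lra.
  - intros. apply gamma_density_ge0.
  - apply is_RInt_gen_infty_iff. intros. apply ex_RInt_const.
    apply filterlim_ext with (fun _ => 0). intros b. rewrite RInt_const.
    unfold scal; simpl; unfold mult; simpl; ring. apply filterlim_const.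
  - now apply upper_gamma_correct.
Qed.

Lemma Gamma_euler_pos (x : R) : 0 < x -> 0 < Gamma_euler x.
Proof.
  intros Hx. apply Rlt_le_trans with (RInt (gamma_density x) 1 2).
  - apply RInt_gt_0. lra.
    + intros u Hu. apply Rmult_lt_0_compat. apply exp_pos. apply Rpower_gt0.
    + intros u Hu. apply continuous_gamma_density. lra.
  - apply (at_right_lim_le (fun _ => RInt (gamma_density x) 1 2) (upper_gamma x)).
    + intros e He. rewrite (upper_gamma_split x e 1), (upper_gamma_split x 1 2) by lra.
      pose proof (upper_gamma_ge0 x 2).
      assert (0 <= RInt (gamma_density x) e 1); [|lra].
      apply RInt_ge_0; [lra | apply ex_RInt_gamma_density; lra |].
      intros; apply gamma_density_ge0.
    + apply filterlim_const.
    + now apply upper_gamma_lim.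
Qed.

Lemma exp_chord (s : R) (th : R) : 0 <= th <= 1 -> exp (th * s) <= 1 + th * (exp s - 1).
Proof.
  intros Hth.
  (* tangent line at th * s, evaluated at 0 and s *)
  assert (H0 : exp (th * s) * (1 - th * s) <= 1).
  { apply Rle_trans with (exp (th * s) * exp (- (th * s))).
    2: { rewrite <- exp_plus, Rplus_opp_r, exp_0. lra. }
    apply Rmult_le_compat_l. apply Rlt_le, exp_pos. pose proof (exp_ineq1_le (- (th * s))). lra. }
  assert (H1 : exp (th * s) * (1 + (1 - th) * s) <= exp s).
  { replace (exp s) with (exp (th * s) * exp ((1 - th) * s)) by (rewrite <- exp_plus; f_equal; ring).
    apply Rmult_le_compat_l. apply Rlt_le, exp_pos. apply exp_ineq1_le. }
  replace (exp (th * s)) with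
    ((1 - th) * (exp (th * s) * (1 - th * s)) + th * (exp (th * s) * (1 + (1 - th) * s))) by ring.
  replace (1 + th * (exp s - 1)) with ((1 - th) * 1 + th * exp s) by ring.
  apply Rplus_le_compat; apply Rmult_le_compat_l; lra.
Qed.

(** The power u^th lies below its tangent at u = s, namely
    s^th (1 + th (u / s - 1)).  Integrated against e^(-u) u^(s-1), the linear term
    vanishes because Gamma (s + 1) = s Gamma (s). *)
Lemma Gamma_euler_gautschi (s th : R) : 0 < s -> 0 <= th <= 1 ->
  Gamma_euler (s + th) <= Rpower s th * Gamma_euler s.
Proof.
  intros Hs Hth.
  apply Rle_trans with
    ((1 - th) * Rpower s th * Gamma_euler s + th * Rpower s th / s * Gamma_euler (s + 1)).
  - apply Gamma_euler_comb_le; try lra. intros u Hu.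
    replace (s + th - 1) with (s - 1 + th) by ring.
    replace (s + 1 - 1) with (s - 1 + 1) by ring.
    rewrite !Rpower_plus, Rpower_1 by auto.
    replace ((1 - th) * Rpower s th * Rpower u (s - 1) + th * Rpower s th / s * (Rpower u (s - 1) * u))
      with (Rpower u (s - 1) * (Rpower s th * (1 + th * (u / s - 1)))) by (field; lra).
    apply Rmult_le_compat_l. apply Rpower_ge0.
    replace u with (s * (u / s)) at 1 by (field; lra).
    rewrite <- Rpower_mult_distr; auto. 2: apply Rdiv_lt_0_compat; auto.
    apply Rmult_le_compat_l. apply Rpower_ge0.
    rewrite <- (exp_ln (u / s)) at 2 by (apply Rdiv_lt_0_compat; auto).
    apply exp_chord; auto.
  - rewrite Gamma_euler_rec by auto. right. field. lra.
Qed.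

Lemma Gamma_euler_convex (x y th : R) : 0 < x -> 0 < y -> 0 <= th <= 1 ->
  Gamma_euler (x + th * (y - x)) <= (1 - th) * Gamma_euler x + th * Gamma_euler y.
Proof.
  intros Hx Hy Hth.
  apply Gamma_euler_comb_le; auto.
  - destruct Hth as [Ht0 Ht1]. destruct (Rle_dec x y) as [H|H].
    + assert (0 <= th * (y - x)) by (apply Rmult_le_pos; lra). lra.
    + assert (0 <= (1 - th) * (x - y)) by (apply Rmult_le_pos; lra). lra.
  - intros u Hu. replace (x + th * (y - x) - 1) with (x - 1 + th * (y - x)) by ring.
    replace (y - 1) with (x - 1 + (y - x)) by ring. rewrite !Rpower_plus.
    replace ((1 - th) * Rpower u (x - 1) + th * (Rpower u (x - 1) * Rpower u (y - x)))
      with (Rpower u (x - 1) * (1 + th * (Rpower u (y - x) - 1))) by ring.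
    apply Rmult_le_compat_l. apply Rpower_ge0.
    unfold Rpower. rewrite Rmult_assoc. now apply exp_chord.
Qed.

(** A positive convex function: the difference at distance [h] from [x] is at most
    [h / d] times the difference at distance [d], and midpoint convexity
    2 Gamma (x) <= Gamma (x + k) + Gamma (x - k) turns the upper bound on one side
    into a lower bound on the other. *)
Lemma Gamma_euler_lipschitz (x d h : R) : 0 < d < x -> Rabs h <= d ->
  Rabs (Gamma_euler (x + h) - Gamma_euler x) <=
  Rabs h / d * (Gamma_euler (x - d) + Gamma_euler (x + d)).
Proof.
  intros Hd Hh.
  pose proof (Gamma_euler_pos (x - d)) as P1. pose proof (Gamma_euler_pos (x + d)) as P2.
  pose proof (Gamma_euler_pos x) as P3. pose proof (Gamma_euler_pos (x + h)) as P4.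
  apply Rabs_le_between in Hh.
  assert (K : forall h, 0 <= h <= d -> 0 <= h / d <= 1).
  { intros k Hk. split. apply Rmult_le_pos; [lra | apply Rlt_le, Rinv_0_lt_compat; lra].
    apply Rmult_le_reg_r with d; [lra|]. field_simplify; lra. }
  assert (Up : forall s, (s = 1 \/ s = -1) -> forall k, 0 <= k <= d ->
    Gamma_euler (x + s * k) <= (1 - k / d) * Gamma_euler x + k / d * Gamma_euler (x + s * d)).
  { intros s Hs k Hk. replace (x + s * k) with (x + k / d * (x + s * d - x)) by (field; lra).
    apply Gamma_euler_convex; auto. lra. destruct Hs; subst; lra. }
  assert (Lo : forall s, (s = 1 \/ s = -1) -> forall k, 0 <= k <= d ->
    2 * Gamma_euler x <= Gamma_euler (x + s * k) + Gamma_euler (x + - s * k)).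
  { intros s Hs k Hk.
    pose proof (Gamma_euler_convex (x + s * k) (x + - s * k) (/2)) as H.
    replace (x + s * k + / 2 * (x + - s * k - (x + s * k))) with x in H by field.
    assert (0 < x + s * k) by (destruct Hs; subst; lra).
    assert (0 < x + - s * k) by (destruct Hs; subst; lra).
    specialize (H ltac:(auto) ltac:(auto) ltac:(lra)). lra. }
  assert (Main : forall s, (s = 1 \/ s = -1) -> forall k, 0 <= k <= d ->
    Rabs (Gamma_euler (x + s * k) - Gamma_euler x) <=
    k / d * (Gamma_euler (x - d) + Gamma_euler (x + d))).
  { intros s Hs k Hk. specialize (K k Hk).
    pose proof (Up s Hs k Hk) as U1.
    pose proof (Up (- s) ltac:(destruct Hs; subst; lra) k Hk) as U2.
    pose proof (Lo s Hs k Hk) as L.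
    assert (Gamma_euler (x + s * d) + Gamma_euler (x + - s * d) = Gamma_euler (x - d) + Gamma_euler (x + d)) as E.
    { destruct Hs; subst.
      - replace (x + 1 * d) with (x + d) by ring. replace (x + - (1) * d) with (x - d) by ring. ring.
      - replace (x + -1 * d) with (x - d) by ring. replace (x + - -1 * d) with (x + d) by ring. ring. }
    assert (Q1 : 0 < Gamma_euler (x + s * d)) by (apply Gamma_euler_pos; destruct Hs; subst; lra).
    assert (Q2 : 0 < Gamma_euler (x + - s * d)) by (apply Gamma_euler_pos; destruct Hs; subst; lra).
    rewrite <- E. set (a := k / d) in *. apply Rabs_le. nra. }
  destruct (Rle_dec 0 h) as [H0|H0].
  - rewrite (Rabs_pos_eq h) by auto. replace (x + h) with (x + 1 * h) by ring. apply Main; [auto|lra].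
  - rewrite (Rabs_left h) by lra. replace (x + h) with (x + -1 * - h) by ring. apply Main; [auto|lra].
Qed.

Lemma continuous_Gamma_euler (x : R) : 0 < x -> continuous Gamma_euler x.
Proof.
  intros Hx. set (d := x / 2). set (B := Gamma_euler (x - d) + Gamma_euler (x + d)).
  assert (HB : 0 < B).
  { apply Rplus_lt_0_compat; apply Gamma_euler_pos; unfold d; lra. }
  assert (Hd : 0 < d < x) by (unfold d; lra).
  apply filterlim_locally. intros eps.
  assert (Hm : 0 < Rmin d (eps * d / B)).
  { apply Rmin_case. lra. apply Rdiv_lt_0_compat; auto. apply Rmult_lt_0_compat; [apply cond_pos | lra]. }
  exists (mkposreal _ Hm). intros y Hy. change (Rabs (y - x) < Rmin d (eps * d / B)) in Hy.
  change (Rabs (Gamma_euler y - Gamma_euler x) < eps).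
  pose proof (Rmin_l d (eps * d / B)). pose proof (Rmin_r d (eps * d / B)).
  replace y with (x + (y - x)) by ring.
  eapply Rle_lt_trans. apply (Gamma_euler_lipschitz x d); auto. lra.
  fold B. apply Rlt_le_trans with (eps * d / B / d * B).
  - apply Rmult_lt_compat_r; auto. apply Rmult_lt_compat_r. apply Rinv_0_lt_compat; lra. lra.
  - right. field. lra.
Qed.

(** * The extension of Gamma to the real line *)

Lemma Gamma_shift_pos (x : R) : 0 < x + INR (Gamma_shift x).
Proof.
  unfold Gamma_shift. destruct (archimed (- x)) as [H _].
  rewrite INR_IZR_INZ. assert (IZR (up (- x)) <= IZR (Z.of_nat (Z.to_nat (up (- x))))).
  { apply IZR_le. lia. }
  lra.
Qed.

Lemma Gamma_euler_poch (x : R) (n : nat) : 0 < x ->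
  Gamma_euler (x + INR n) = poch x n * Gamma_euler x.
Proof.
  intros Hx. induction n as [|n IH].
  - simpl. rewrite Rplus_0_r. ring.
  - rewrite S_INR. replace (x + (INR n + 1)) with (x + INR n + 1) by ring.
    pose proof (pos_INR n). rewrite Gamma_euler_rec by lra. rewrite IH. simpl. ring.
Qed.

Lemma poch_add (a : R) (m n : nat) : poch a (m + n) = poch a m * poch (a + INR m) n.
Proof.
  induction n as [|n IH].
  - rewrite Nat.add_0_r. simpl. ring.
  - rewrite Nat.add_succ_r. simpl. rewrite IH, plus_INR. ring.
Qed.

(** Any sufficiently large shift computes 1 / Gamma, poles included: there both
    sides are 0.  A shift that is fixed while [x] varies is what continuity and
    the recurrence need, since [Gamma_shift] jumps. *)
Lemma Rinv_Gamma (x : R) (n : nat) : 0 < x + INR n ->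
  / Gamma x = poch x n / Gamma_euler (x + INR n).
Proof.
  intros Hn. unfold Gamma.
  assert (K : forall m n, (m <= n)%nat -> 0 < x + INR m ->
    poch x m / Gamma_euler (x + INR m) = poch x n / Gamma_euler (x + INR n)).
  { intros a b Hab Ha. rewrite <- (Nat.sub_add a b Hab), Nat.add_comm. set (c := (b - a)%nat).
    rewrite poch_add, plus_INR, <- Rplus_assoc, (Gamma_euler_poch (x + INR a) c) by auto.
    pose proof (Gamma_euler_pos _ Ha) as H1.
    assert (H2 : 0 < Gamma_euler (x + INR a + INR c)).
    { apply Gamma_euler_pos. pose proof (pos_INR c). lra. }
    rewrite (Gamma_euler_poch (x + INR a) c) in H2 by auto.
    field. split; [lra|]. intros E. rewrite E, Rmult_0_l in H2. lra. }
  pose proof (Gamma_shift_pos x) as Hs. set (m := Gamma_shift x) in *.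
  unfold Rdiv at 1. rewrite Rinv_mult, Rinv_inv, Rmult_comm.
  change (poch x m / Gamma_euler (x + INR m) = poch x n / Gamma_euler (x + INR n)).
  destruct (Nat.le_ge_cases m n). now apply K. symmetry. now apply K.
Qed.

Lemma Gamma_pos_eq (x : R) : 0 < x -> Gamma x = Gamma_euler x.
Proof.
  intros Hx. pose proof (Rinv_Gamma x 0) as H. simpl in H. rewrite Rplus_0_r in H.
  specialize (H Hx). apply Rinv_eq_reg. rewrite H. unfold Rdiv. ring.
Qed.

(** Stated for the reciprocal, the functional equation has no exceptions. *)
Lemma Rinv_Gamma_rec (x : R) : / Gamma x = x * / Gamma (x + 1).
Proof.
  pose proof (Gamma_shift_pos (x + 1)) as Hs. set (n := Gamma_shift (x + 1)) in *.
  rewrite (Rinv_Gamma (x + 1) n) by auto. rewrite (Rinv_Gamma x (S n)).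
  2: { rewrite S_INR. lra. }
  change (S n) with (1 + n)%nat. rewrite poch_add. rewrite plus_INR. simpl (poch x 1). simpl (INR 1).
  rewrite <- Rplus_assoc. unfold Rdiv. ring.
Qed.

Lemma poch_neq0 (x : R) (n : nat) : ~ is_integer x -> poch x n <> 0.
Proof.
  intros Hx. induction n as [|n IH]; simpl. lra.
  apply Rmult_integral_contrapositive_currified; auto.
  intros E. apply Hx. exists (- Z.of_nat n)%Z. rewrite opp_IZR, <- INR_IZR_INZ. lra.
Qed.

Lemma Gamma_neq0 (x : R) : ~ is_integer x -> Gamma x <> 0.
Proof.
  intros Hx. unfold Gamma. pose proof (Gamma_euler_pos _ (Gamma_shift_pos x)).
  unfold Rdiv. apply Rmult_integral_contrapositive_currified. lra.
  apply Rinv_neq_0_compat. now apply poch_neq0.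
Qed.

Lemma not_integer_shift (x : R) (n : Z) : ~ is_integer x -> ~ is_integer (x + IZR n).
Proof. intros H [m Hm]. apply H. exists (m - n)%Z. rewrite minus_IZR. lra. Qed.

Lemma Gamma_rec (x : R) : ~ is_integer x -> Gamma (x + 1) = x * Gamma x.
Proof.
  intros Hx. pose proof (Rinv_Gamma_rec x) as H.
  pose proof (Gamma_neq0 x Hx). pose proof (Gamma_neq0 (x + 1) (not_integer_shift x 1 Hx)).
  replace (Gamma (x + 1)) with (Gamma (x + 1) * (Gamma x * / Gamma x)) by (field; auto).
  rewrite H. field. auto.
Qed.

Lemma Gamma_poch (x : R) (n : nat) : ~ is_integer x -> Gamma (x + INR n) = poch x n * Gamma x.
Proof.
  intros Hx. induction n as [|n IH].
  - simpl. rewrite Rplus_0_r. ring.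
  - rewrite S_INR, <- Rplus_assoc, Gamma_rec.
    + rewrite IH. simpl. ring.
    + rewrite INR_IZR_INZ. now apply not_integer_shift.
Qed.

Lemma continuous_poch (n : nat) (x : R) : continuous (fun t => poch t n) x.
Proof.
  induction n as [|n IH]; simpl.
  - apply continuous_const.
  - apply (continuous_mult (fun t => poch t n) (fun t => t + INR n)); auto.
    apply (continuous_plus (fun t => t) (fun _ => INR n)). apply continuous_id. apply continuous_const.
Qed.

Lemma continuous_Rinv_Gamma (x : R) : continuous (fun t => / Gamma t) x.
Proof.
  pose proof (Gamma_shift_pos x) as Hs. set (n := Gamma_shift x) in *.
  apply continuous_ext_loc with (g := fun t => poch t n * / Gamma_euler (t + INR n)).
  - exists (mkposreal _ Hs). intros t Ht. change (Rabs (t - x) < x + INR n) in Ht.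
    apply Rabs_def2 in Ht. symmetry. rewrite (Rinv_Gamma t n). reflexivity. lra.
  - apply (continuous_mult (fun t => poch t n) (fun t => / Gamma_euler (t + INR n))).
    apply continuous_poch.
    apply (continuous_comp (fun t => Gamma_euler (t + INR n)) Rinv).
    + apply (continuous_comp (fun t => t + INR n) Gamma_euler).
      apply (continuous_plus (fun t => t) (fun _ => INR n)). apply continuous_id. apply continuous_const.
      now apply continuous_Gamma_euler.
    + apply continuous_Rinv. apply Rgt_not_eq. now apply Gamma_euler_pos.
Qed.

(** * The reflection formula *)

Definition cos_moment (y : R) (m : nat) : R :=
  RInt (fun t => cos (y * t) * cos t ^ m) 0 (PI / 2).

Lemma cos_moment_correct (y : R) (m : nat) :
  is_RInt (fun t => cos (y * t) * cos t ^ m) 0 (PI / 2) (cos_moment y m).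
Proof.
  apply (@RInt_correct R_CompleteNormedModule), (@ex_RInt_continuous R_CompleteNormedModule).
  intros t _. apply (ex_derive_continuous (fun t : R => cos (y * t) * cos t ^ m)).
  auto_derive. exact I.
Qed.

(** Integrate the derivative of
    y sin (y t) cos^(m+2) t - (m + 2) cos (y t) cos^(m+1) t sin t, a function that
    vanishes at both ends. *)
Lemma cos_moment_rec (y : R) (m : nat) :
  (INR (S (S m)) ^ 2 - y ^ 2) * cos_moment y (S (S m)) =
  INR (S (S m)) * INR (S m) * cos_moment y m.
Proof.
  set (M := INR (S (S m))).
  set (W := fun t => y * sin (y * t) * cos t ^ S (S m) - M * cos (y * t) * cos t ^ S m * sin t).
  set (w := fun t => (y ^ 2 - M ^ 2) * (cos (y * t) * cos t ^ S (S m))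
     + M * INR (S m) * (cos (y * t) * cos t ^ m)).
  assert (H1 : is_RInt w 0 (PI / 2) (W (PI / 2) - W 0)).
  { apply (is_RInt_derive W w).
    - intros t _. unfold W, w. auto_derive. exact I.
      change (pred (S (S m))) with (S m). change (pred (S m)) with m.
      assert (E : sin t * sin t = 1 - cos t * cos t).
      { pose proof (sin2_cos2 t) as H. unfold Rsqr in H. lra. }
      change (match m with O => 1 | S _ => INR m + 1 end) with (INR (S m)) in *.
      change (INR (S m) + 1) with (INR (S (S m))). fold M.
      assert (EM : M = INR (S m) + 1) by (unfold M; now rewrite S_INR).
      simpl (cos t ^ S _).
      match goal with |- ?a = ?b =>
        replace a with (y ^ 2 * cos (y * t) * (cos t * (cos t * cos t ^ m))
          + M * INR (S m) * cos (y * t) * cos t ^ m * (sin t * sin t)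
          - M * cos (y * t) * cos t ^ m * cos t * cos t) by ring end.
      rewrite E, EM. ring.
    - intros t _. unfold w.
      apply (ex_derive_continuous (fun t : R => (y ^ 2 - M ^ 2) * (cos (y * t) * cos t ^ S (S m))
        + M * INR (S m) * (cos (y * t) * cos t ^ m))). auto_derive. exact I. }
  assert (H2 : is_RInt w 0 (PI / 2) ((y ^ 2 - M ^ 2) * cos_moment y (S (S m))
     + M * INR (S m) * cos_moment y m)).
  { apply (is_RInt_plus (V := R_NormedModule));
    apply (is_RInt_scal (V := R_NormedModule)); apply cos_moment_correct. }
  pose proof (is_RInt_unique _ _ _ _ H1) as E1.
  pose proof (is_RInt_unique _ _ _ _ H2) as E2.
  assert (W (PI / 2) = 0) by (unfold W; rewrite cos_PI2; simpl; ring).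
  assert (W 0 = 0) by (unfold W; rewrite Rmult_0_r, sin_0; ring).
  rewrite E1 in E2. lra.
Qed.

Lemma cos_moment_0_pos (m : nat) : 0 < cos_moment 0 m.
Proof.
  pose proof PI_RGT_0.
  apply RInt_gt_0. lra.
  - intros t Ht. rewrite Rmult_0_l, cos_0, Rmult_1_l. apply pow_lt, cos_gt_0; lra.
  - intros t _. apply (ex_derive_continuous (fun t : R => cos (0 * t) * cos t ^ m)).
    auto_derive. exact I.
Qed.

(** Pointwise cos (2 x t) = 1 - 2 sin^2 (x t) >= 1 - 2 sin^2 t = 2 cos^2 t - 1,
    because 0 <= x t <= t <= pi / 2; the recurrence at y = 0 evaluates the
    integral of the right-hand side. *)
Lemma cos_moment_near (x : R) (n : nat) : 0 <= x <= 1 ->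
  (1 - / INR (S n)) * cos_moment 0 (2 * n) <= cos_moment (2 * x) (2 * n) <= cos_moment 0 (2 * n).
Proof.
  intros Hx. pose proof PI_RGT_0 as HPI.
  assert (Hc : forall t, 0 < t < PI / 2 -> 0 <= cos t ^ (2 * n))
    by (intros t Ht; apply pow_le, Rlt_le, cos_gt_0; lra).
  split.
  - assert (E : (1 - / INR (S n)) * cos_moment 0 (2 * n) =
      2 * cos_moment 0 (S (S (2 * n))) - cos_moment 0 (2 * n)).
    { pose proof (cos_moment_rec 0 (2 * n)) as H.
      rewrite !S_INR, mult_INR in H. change (INR 2) with 2 in H. rewrite S_INR.
      pose proof (pos_INR n).
      assert (E : cos_moment 0 (S (S (2 * n))) = (2 * INR n + 1) / (2 * INR n + 2) * cos_moment 0 (2 * n)).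
      { apply Rmult_eq_reg_l with ((2 * INR n + 2) ^ 2). 2: apply pow_nonzero; lra.
        replace ((2 * INR n + 2) ^ 2 * cos_moment 0 (S (S (2 * n)))) with
          (((2 * INR n + 1 + 1) ^ 2 - 0 ^ 2) * cos_moment 0 (S (S (2 * n)))) by ring.
        rewrite H. field. lra. }
      rewrite E. field. lra. }
    rewrite E.
    apply (is_RInt_le (fun t => 2 * (cos (0 * t) * cos t ^ S (S (2 * n))) - cos (0 * t) * cos t ^ (2 * n))
      (fun t => cos (2 * x * t) * cos t ^ (2 * n)) 0 (PI / 2)); [lra | | apply cos_moment_correct | ].
    + apply (is_RInt_minus (V := R_NormedModule)).
      apply (is_RInt_scal (V := R_NormedModule)). apply cos_moment_correct. apply cos_moment_correct.
    + intros t Ht. rewrite Rmult_0_l, cos_0.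
      replace (2 * (1 * cos t ^ S (S (2 * n))) - 1 * cos t ^ (2 * n))
        with ((2 * (cos t * cos t) - 1) * cos t ^ (2 * n)) by (simpl; ring).
      apply Rmult_le_compat_r; auto.
      replace (2 * x * t) with (2 * (x * t)) by ring.
      rewrite cos_2a_sin.
      assert (Hs : 0 <= sin (x * t) <= sin t).
      { assert (0 <= x * t) by (apply Rmult_le_pos; lra).
        assert (0 <= (1 - x) * t) by (apply Rmult_le_pos; lra).
        split. apply sin_ge_0; lra. apply sin_incr_1; lra. }
      pose proof (sin2_cos2 t) as H. unfold Rsqr in H.
      assert (sin (x * t) * sin (x * t) <= sin t * sin t) by (apply Rmult_le_compat; lra).
      lra.
  - apply (is_RInt_le (fun t => cos (2 * x * t) * cos t ^ (2 * n)) (fun t => cos (0 * t) * cos t ^ (2 * n)) 0 (PI / 2));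
      [lra | apply cos_moment_correct | apply cos_moment_correct |].
    intros t Ht. apply Rmult_le_compat_r; auto. rewrite Rmult_0_l, cos_0. apply COS_bound.
Qed.

Definition cos_ratio (x : R) (n : nat) : R := cos_moment (2 * x) (2 * n) / cos_moment 0 (2 * n).

Lemma cos_ratio_rec (x : R) (n : nat) :
  cos_ratio x n = (INR (S n) ^ 2 - x ^ 2) / INR (S n) ^ 2 * cos_ratio x (S n).
Proof.
  unfold cos_ratio. replace (2 * S n)%nat with (S (S (2 * n))) by lia.
  pose proof (cos_moment_rec (2 * x) (2 * n)) as H1. pose proof (cos_moment_rec 0 (2 * n)) as H0.
  pose proof (cos_moment_0_pos (2 * n)). pose proof (cos_moment_0_pos (S (S (2 * n)))).
  rewrite !S_INR, mult_INR in *. change (INR 2) with 2 in *. pose proof (pos_INR n).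
  assert (E1 : cos_moment (2 * x) (2 * n) = ((2 * INR n + 2) ^ 2 - 4 * x ^ 2) / ((2 * INR n + 2) * (2 * INR n + 1)) * cos_moment (2 * x) (S (S (2 * n)))).
  { apply Rmult_eq_reg_l with ((2 * INR n + 1 + 1) * (2 * INR n + 1)).
    rewrite <- H1. field. lra. apply Rmult_integral_contrapositive_currified; lra. }
  assert (E0 : cos_moment 0 (2 * n) = ((2 * INR n + 2) / (2 * INR n + 1)) * cos_moment 0 (S (S (2 * n)))).
  { apply Rmult_eq_reg_l with ((2 * INR n + 1 + 1) * (2 * INR n + 1)).
    rewrite <- H0. field. lra. apply Rmult_integral_contrapositive_currified; lra. }
  rewrite E1, E0. field. lra.
Qed.

Lemma cos_ratio_0 (x : R) : 0 < x -> cos_ratio x 0 = sin (PI * x) / (PI * x).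
Proof.
  intros Hx. pose proof PI_RGT_0. unfold cos_ratio. simpl (2 * 0)%nat.
  assert (E1 : cos_moment (2 * x) 0 = sin (PI * x) / (2 * x)).
  { apply is_RInt_unique.
    apply (is_RInt_ext (fun t => cos (2 * x * t))). intros t _. simpl. symmetry. apply Rmult_1_r.
    evar_last. apply (is_RInt_derive (fun t => sin (2 * x * t) / (2 * x)) (fun t => cos (2 * x * t))).
    - intros t _. auto_derive. exact I. field. lra.
    - intros t _. apply (ex_derive_continuous (fun t : R => cos (2 * x * t))). auto_derive. exact I.
    - unfold minus, plus, opp; simpl. rewrite Rmult_0_r, sin_0.
      replace (2 * x * (PI / 2)) with (PI * x) by field. field. lra. }
  assert (E0 : cos_moment 0 0 = PI / 2).
  { apply is_RInt_unique.
    apply (is_RInt_ext (fun t => 1)). intros t _. simpl. rewrite Rmult_0_l, cos_0. ring.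
    evar_last. apply (@is_RInt_const R_NormedModule). unfold scal; simpl; unfold mult; simpl. field. }
  rewrite E1, E0. field. lra.
Qed.

Definition gamma_ratio (x : R) (n : nat) : R :=
  Gamma_euler (INR n + 1 + x) * Gamma_euler (INR n + 1 - x) / Gamma_euler (INR n + 1) ^ 2.

Lemma gamma_ratio_rec (x : R) (n : nat) : 0 < x < 1 ->
  gamma_ratio x (S n) = (INR (S n) ^ 2 - x ^ 2) / INR (S n) ^ 2 * gamma_ratio x n.
Proof.
  intros Hx. unfold gamma_ratio. rewrite S_INR. pose proof (pos_INR n).
  replace (INR n + 1 + 1 + x) with (INR n + 1 + x + 1) by ring.
  replace (INR n + 1 + 1 - x) with (INR n + 1 - x + 1) by ring.
  rewrite !Gamma_euler_rec by lra.
  pose proof (Gamma_euler_pos (INR n + 1)). field. lra.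
Qed.

(** With N = n + 1, Gautschi's inequality from N + 1 to N + 1 + x and from N to
    N + 1 - x bounds the numerator above; from N + 1 + x to N + 2 and from
    N + 1 - x to N + 1 it bounds it below. *)
Lemma gamma_ratio_near (x : R) (n : nat) : 0 < x < 1 ->
  INR (S n) / (INR (S n) + 1 + 1) <= gamma_ratio x (S n) <= (INR (S n) + 1) / INR (S n).
Proof.
  intros Hx. unfold gamma_ratio. set (N := INR (S n)).
  assert (HN : 1 <= N) by (unfold N; rewrite S_INR; pose proof (pos_INR n); lra).
  pose proof (Gamma_euler_pos (N + 1)) as P. pose proof (Gamma_euler_pos (N + 1 + x)) as P1.
  pose proof (Gamma_euler_pos (N + 1 - x)) as P2. pose proof (Gamma_euler_pos N) as P3.
  set (G := Gamma_euler (N + 1)) in *.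
  split.
  - pose proof (Gamma_euler_gautschi (N + 1 + x) (1 - x)) as U1.
    replace (N + 1 + x + (1 - x)) with (N + 1 + 1) in U1 by ring.
    rewrite Gamma_euler_rec in U1 by lra. fold G in U1.
    pose proof (Gamma_euler_gautschi (N + 1 - x) x) as U2.
    replace (N + 1 - x + x) with (N + 1) in U2 by ring. fold G in U2.
    specialize (U1 ltac:(lra) ltac:(lra)). specialize (U2 ltac:(lra) ltac:(lra)).
    set (a := Rpower (N + 1 + x) (1 - x)) in *. set (b := Rpower (N + 1 - x) x) in *.
    assert (Hab : a * b <= N + 1 + 1).
    { replace (N + 1 + 1) with (Rpower (N + 1 + 1) (1 - x) * Rpower (N + 1 + 1) x).
      - apply Rmult_le_compat; try apply Rpower_ge0; apply Rle_Rpower_l; lra.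
      - rewrite <- Rpower_plus. replace (1 - x + x) with 1 by ring. apply Rpower_1. lra. }
    assert (H : (N + 1) * G ^ 2 <= (N + 1 + 1) * (Gamma_euler (N + 1 + x) * Gamma_euler (N + 1 - x))).
    { apply Rle_trans with ((a * Gamma_euler (N + 1 + x)) * (b * Gamma_euler (N + 1 - x))).
      - replace ((N + 1) * G ^ 2) with ((N + 1) * G * G) by ring.
        apply Rmult_le_compat; auto. apply Rmult_le_pos; lra. lra.
      - replace (a * Gamma_euler (N + 1 + x) * (b * Gamma_euler (N + 1 - x))) with
          (a * b * (Gamma_euler (N + 1 + x) * Gamma_euler (N + 1 - x))) by ring.
        apply Rmult_le_compat_r; auto. apply Rmult_le_pos; lra. }
    apply Rmult_le_reg_r with ((N + 1 + 1) * G ^ 2).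
    apply Rmult_lt_0_compat. lra. apply pow_lt; lra.
    replace (N / (N + 1 + 1) * ((N + 1 + 1) * G ^ 2)) with (N * G ^ 2) by (field; lra).
    replace (Gamma_euler (N + 1 + x) * Gamma_euler (N + 1 - x) / G ^ 2 * ((N + 1 + 1) * G ^ 2))
      with ((N + 1 + 1) * (Gamma_euler (N + 1 + x) * Gamma_euler (N + 1 - x))) by (field; lra).
    assert (0 <= G ^ 2) by apply pow2_ge_0. lra.
  - pose proof (Gamma_euler_gautschi (N + 1) x) as U1. fold G in U1.
    pose proof (Gamma_euler_gautschi N (1 - x)) as U2.
    replace (N + (1 - x)) with (N + 1 - x) in U2 by ring.
    assert (EG : G = N * Gamma_euler N) by (unfold G; apply Gamma_euler_rec; lra).
    specialize (U1 ltac:(lra) ltac:(lra)). specialize (U2 ltac:(lra) ltac:(lra)).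
    assert (Hab : Rpower (N + 1) x * Rpower N (1 - x) <= N + 1).
    { apply Rle_trans with (Rpower (N + 1) x * Rpower (N + 1) (1 - x)).
      - apply Rmult_le_compat_l. apply Rpower_ge0. apply Rle_Rpower_l; lra.
      - right. rewrite <- Rpower_plus. replace (x + (1 - x)) with 1 by ring. apply Rpower_1. lra. }
    assert (H : Gamma_euler (N + 1 + x) * Gamma_euler (N + 1 - x) <= (N + 1) * (G * Gamma_euler N)).
    { apply Rle_trans with ((Rpower (N + 1) x * G) * (Rpower N (1 - x) * Gamma_euler N)).
      - apply Rmult_le_compat; lra.
      - replace (Rpower (N + 1) x * G * (Rpower N (1 - x) * Gamma_euler N)) with
          (Rpower (N + 1) x * Rpower N (1 - x) * (G * Gamma_euler N)) by ring.
        apply Rmult_le_compat_r; auto. apply Rmult_le_pos; lra. }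
    apply Rmult_le_reg_r with (G ^ 2). apply pow_lt; lra.
    replace (Gamma_euler (N + 1 + x) * Gamma_euler (N + 1 - x) / G ^ 2 * G ^ 2)
      with (Gamma_euler (N + 1 + x) * Gamma_euler (N + 1 - x)) by (field; lra).
    apply Rle_trans with (1 := H). right. rewrite EG. field. lra.
Qed.

Lemma Gamma_euler_reflection (x : R) : 0 < x < 1 ->
  Gamma_euler x * Gamma_euler (1 - x) * sin (PI * x) = PI.
Proof.
  intros Hx. pose proof PI_RGT_0 as HPI.
  assert (Hconst : forall n, gamma_ratio x n * cos_ratio x n = gamma_ratio x 0 * cos_ratio x 0).
  { induction n as [|n IH]; auto. rewrite <- IH, gamma_ratio_rec by auto.
    rewrite (cos_ratio_rec x n). ring. }
  set (P := gamma_ratio x 0 * cos_ratio x 0) in *.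
  (* with N = n + 1 the product lies between N^2 / ((N + 1) (N + 2)) >= 1 - 3 / N
     and (N + 1) / N *)
  assert (Hlim : forall n, Rabs (P - 1) <= 3 / INR (S n)).
  { intros n. rewrite <- (Hconst (S n)).
    destruct (gamma_ratio_near x n Hx) as [G1 G2].
    destruct (cos_moment_near x (S n)) as [C1 C2]; [lra|].
    pose proof (cos_moment_0_pos (2 * S n)) as C0.
    set (N := INR (S n)) in *. rewrite S_INR in C1. fold N in C1.
    assert (HN : 1 <= N) by (unfold N; rewrite S_INR; pose proof (pos_INR n); lra).
    assert (R2 : cos_ratio x (S n) <= 1).
    { unfold cos_ratio. apply Rmult_le_reg_r with (cos_moment 0 (2 * S n)); auto.
      unfold Rdiv. rewrite Rmult_assoc, Rinv_l by lra. lra. }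
    assert (R1 : N / (N + 1) <= cos_ratio x (S n)).
    { unfold cos_ratio. apply Rmult_le_reg_r with (cos_moment 0 (2 * S n)); auto.
      unfold Rdiv at 2. rewrite Rmult_assoc, Rinv_l by lra.
      replace (N / (N + 1)) with (1 - / (N + 1)) by (field; lra). lra. }
    set (g := gamma_ratio x (S n)) in *. set (r := cos_ratio x (S n)) in *.
    assert (0 < N / (N + 1)) by (apply Rdiv_lt_0_compat; lra).
    assert (0 < N / (N + 1 + 1)) by (apply Rdiv_lt_0_compat; lra).
    assert (U : g * r <= (N + 1) / N) by nra.
    assert (L : N / (N + 1 + 1) * (N / (N + 1)) <= g * r) by (apply Rmult_le_compat; lra).
    assert (E1 : (N + 1) / N = 1 + / N) by (field; lra).
    assert (E2 : 1 - 3 / N <= N / (N + 1 + 1) * (N / (N + 1))).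
    { apply Rmult_le_reg_r with (N * ((N + 1 + 1) * (N + 1))). nra.
      replace (N / (N + 1 + 1) * (N / (N + 1)) * (N * ((N + 1 + 1) * (N + 1)))) with (N ^ 3) by (field; lra).
      replace ((1 - 3 / N) * (N * ((N + 1 + 1) * (N + 1)))) with ((N - 3) * ((N + 1 + 1) * (N + 1))) by (field; lra).
      nra. }
    assert (0 < / N) by (apply Rinv_0_lt_compat; lra).
    unfold Rdiv in *. apply Rabs_le. lra. }
  assert (HP : P = 1).
  { destruct (Req_dec P 1) as [|Hne]; auto. exfalso.
    assert (Hd : 0 < Rabs (P - 1)) by (apply Rabs_pos_lt; lra).
    destruct (archimed_cor1 (Rabs (P - 1) / 3)) as [n [Hn Hn0]]. lra.
    destruct n as [|n]; [lia|]. specialize (Hlim n). unfold Rdiv in *. lra. }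
  unfold P, gamma_ratio in HP. simpl INR in HP. rewrite cos_ratio_0 in HP by lra.
  replace (0 + 1 + x) with (x + 1) in HP by ring. replace (0 + 1 - x) with (1 - x) in HP by ring.
  replace (0 + 1) with 1 in HP by ring.
  rewrite Gamma_euler_1, Gamma_euler_rec in HP by lra.
  apply Rmult_eq_reg_r with (/ PI). 2: apply Rinv_neq_0_compat; lra.
  rewrite Rinv_r by lra. etransitivity; [|exact HP]. field. lra.
Qed.

(** * Hankel's formula, real form *)

Definition circle_integral (b rho : R) : R :=
  RInt (fun t => exp (rho * cos t) * cos (rho * sin t + b * t)) (- PI) PI.

Lemma circle_integral_correct (b rho : R) :
  is_RInt (fun t => exp (rho * cos t) * cos (rho * sin t + b * t)) (- PI) PI (circle_integral b rho).
Proof.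
  apply (@RInt_correct R_CompleteNormedModule), (@ex_RInt_continuous R_CompleteNormedModule).
  intros t _. apply (ex_derive_continuous (fun t : R => exp (rho * cos t) * cos (rho * sin t + b * t))).
  auto_derive. exact I.
Qed.

(** The right-hand side is the increment over (-pi, pi) of
    e^(rho cos t) sin (rho sin t + b t), the imaginary part of e^w w^b up to the
    factor rho^b. *)
Lemma circle_integral_rec (b rho : R) :
  rho * circle_integral (b + 1) rho + b * circle_integral b rho = 2 * exp (- rho) * sin (b * PI).
Proof.
  set (f := fun c t => exp (rho * cos t) * cos (rho * sin t + c * t)).
  set (W := fun t => exp (rho * cos t) * sin (rho * sin t + b * t)).
  assert (H1 : is_RInt (fun t => rho * f (b + 1) t + b * f b t) (- PI) PI (W PI - W (- PI))).
  { apply (is_RInt_derive W).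
    - intros t _. unfold W, f. auto_derive. exact I.
      replace (rho * sin t + (b + 1) * t) with (rho * sin t + b * t + t) by ring.
      rewrite (cos_plus (rho * sin t + b * t) t). ring.
    - intros t _. unfold f. 
      apply (ex_derive_continuous (fun t : R => rho * (exp (rho * cos t) * cos (rho * sin t + (b + 1) * t)) +
        b * (exp (rho * cos t) * cos (rho * sin t + b * t)))). auto_derive. exact I. }
  assert (H2 : is_RInt (fun t => rho * f (b + 1) t + b * f b t) (- PI) PI
    (rho * circle_integral (b + 1) rho + b * circle_integral b rho)).
  { apply (is_RInt_plus (V := R_NormedModule));
    apply (is_RInt_scal (V := R_NormedModule)); apply circle_integral_correct. }
  rewrite <- (is_RInt_unique _ _ _ _ H2), (is_RInt_unique _ _ _ _ H1).
  unfold W. rewrite cos_neg, sin_neg, cos_PI, sin_PI.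
  replace (rho * -0 + b * - PI) with (- (b * PI)) by ring.
  replace (rho * 0 + b * PI) with (b * PI) by ring.
  rewrite sin_neg. replace (rho * -1) with (- rho) by ring. ring.
Qed.

Lemma circle_integral_derive (b rho : R) :
  is_derive (circle_integral b) rho (circle_integral (b + 1) rho).
Proof.
  set (f := fun r t => exp (r * cos t) * cos (r * sin t + b * t)).
  assert (HD : forall r t, is_derive (fun z => f z t) r (exp (r * cos t) * cos (r * sin t + (b + 1) * t))).
  { intros r t. unfold f. auto_derive. exact I.
    replace (r * sin t + (b + 1) * t) with (r * sin t + b * t + t) by ring.
    rewrite (cos_plus (r * sin t + b * t) t). ring. }
  replace (circle_integral (b + 1) rho) with (RInt (fun t => Derive (fun u => f u t) rho) (- PI) PI).
  2: { unfold circle_integral. apply RInt_ext. intros t _. now apply is_derive_unique. }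
  apply (is_derive_RInt_param f (- PI) PI rho).
  - apply filter_forall. intros r t _. eexists. apply HD.
  - intros t _.
    apply continuity_2d_pt_ext with (fun r t => exp (r * cos t) * cos (r * sin t + (b + 1) * t)).
    { intros r s. symmetry. now apply is_derive_unique. }
    assert (Hc : forall x, continuity_pt cos x) by apply continuity_cos.
    assert (Hs : forall x, continuity_pt sin x) by apply continuity_sin.
    assert (He : forall x, continuity_pt exp x).
    { intros x. apply derivable_continuous_pt, derivable_pt_exp. }
    apply continuity_2d_pt_mult.
    + apply (continuity_1d_2d_pt_comp exp (fun r t => r * cos t)); auto.
      apply continuity_2d_pt_mult. apply continuity_2d_pt_id1.
      apply (continuity_1d_2d_pt_comp cos (fun r t => t)); auto. apply continuity_2d_pt_id2.
    + apply (continuity_1d_2d_pt_comp cos (fun r t => r * sin t + (b + 1) * t)); auto.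
      apply continuity_2d_pt_plus; apply continuity_2d_pt_mult.
      * apply continuity_2d_pt_id1.
      * apply (continuity_1d_2d_pt_comp sin (fun r t => t)); auto. apply continuity_2d_pt_id2.
      * apply continuity_2d_pt_const.
      * apply continuity_2d_pt_id2.
  - apply filter_forall. intros r. eexists. apply circle_integral_correct.
Qed.

Lemma upper_gamma_derive (x e : R) : 0 < e ->
  is_derive (upper_gamma x) e (- gamma_density x e).
Proof.
  intros He.
  assert (HL : locally e (fun y => 0 < y)).
  { exists (mkposreal e He). intros y Hy. change (Rabs (y - e) < e) in Hy.
    apply Rabs_def2 in Hy. lra. }
  apply is_derive_ext_loc with (fun y => RInt (gamma_density x) y 1 + upper_gamma x 1).
  - apply filter_imp with (2 := HL). intros y Hy. symmetry. apply upper_gamma_split; lra.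
  - evar_last. apply (is_derive_plus (fun y => RInt (gamma_density x) y 1) (fun _ => upper_gamma x 1)).
    + apply (is_derive_RInt' (gamma_density x) (fun y => RInt (gamma_density x) y 1) e 1).
      * apply filter_imp with (2 := HL). intros y Hy.
        apply (@RInt_correct R_CompleteNormedModule). apply ex_RInt_gamma_density; lra.
      * now apply continuous_gamma_density.
    + apply (@is_derive_const R_AbsRing R_NormedModule).
    + unfold plus, opp, zero; simpl. ring.
Qed.

(** The integral of e^w w^(-a) along Hankel's contour of radius [rho], divided by
    i: the circle contributes the first term; the two rays, whose arguments
    differ by 2 pi, contribute the second. *)
Definition hankel_sum (a rho : R) : R :=
  Rpower rho (1 - a) * circle_integral (1 - a) rho + 2 * sin (PI * a) * upper_gamma (1 - a) rho.

(** The change of the circle term is its boundary contribution, which is what the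
    rays lose when they are shortened. *)
Lemma hankel_sum_derive (a rho : R) : 0 < rho -> is_derive (hankel_sum a) rho 0.
Proof.
  intros Hr. set (b := 1 - a). evar_last.
  - apply (is_derive_plus (fun r => Rpower r b * circle_integral b r)
      (fun r => 2 * sin (PI * a) * upper_gamma b r)).
    + apply (is_derive_mult (fun r => Rpower r b) (circle_integral b)).
      now apply is_derive_Rpower. apply circle_integral_derive. apply Rmult_comm.
    + apply (is_derive_scal (upper_gamma b)). now apply upper_gamma_derive.
  - unfold plus, mult; simpl. unfold mult; simpl. unfold gamma_density.
    pose proof (circle_integral_rec b rho) as H.
    replace (sin (b * PI)) with (sin (PI * a)) in H.
    2: { rewrite <- (sin_PI_x (PI * a)). f_equal. unfold b. ring. }
    replace (Rpower rho b) with (Rpower rho (b - 1) * rho).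
    2: { rewrite <- (Rpower_1 rho) at 2 by auto. rewrite <- Rpower_plus. f_equal. ring. }
    replace (b * Rpower rho (b - 1) * circle_integral b rho + Rpower rho (b - 1) * rho * circle_integral (b + 1) rho)
      with (Rpower rho (b - 1) * (rho * circle_integral (b + 1) rho + b * circle_integral b rho)) by ring.
    rewrite H. ring.
Qed.

Lemma hankel_sum_const (a r1 r2 : R) : 0 < r1 -> 0 < r2 -> hankel_sum a r1 = hankel_sum a r2.
Proof.
  assert (K : forall s t, 0 < s < t -> hankel_sum a s = hankel_sum a t).
  { intros s t Hst. apply (eq_is_derive (hankel_sum a)); [|lra].
    intros u Hu. apply hankel_sum_derive. lra. }
  intros H1 H2. destruct (Rtotal_order r1 r2) as [H|[H|H]].
  - now apply K. - now subst. - symmetry. now apply K.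
Qed.

Lemma hankel_sum_rec (a rho : R) : 0 < rho -> hankel_sum (a - 1) rho = (a - 1) * hankel_sum a rho.
Proof.
  intros Hr. unfold hankel_sum. replace (1 - (a - 1)) with (1 - a + 1) by ring.
  set (b := 1 - a). pose proof (circle_integral_rec b rho) as H.
  replace (sin (b * PI)) with (sin (PI * a)) in H.
  2: { rewrite <- (sin_PI_x (PI * a)). f_equal. unfold b. ring. }
  rewrite upper_gamma_rec by auto. rewrite Rpower_plus, Rpower_1 by auto.
  replace (sin (PI * (a - 1))) with (- sin (PI * a)).
  2: { replace (PI * (a - 1)) with (- (PI - PI * a)) by ring. rewrite sin_neg, sin_PI_x. ring. }
  replace (a - 1) with (- b) by (unfold b; ring).
  apply Rminus_diag_uniq.
  match goal with |- ?l = 0 => replace l with (Rpower rho b *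
    (rho * circle_integral (b + 1) rho + b * circle_integral b rho - 2 * exp (- rho) * sin (PI * a))) by ring end.
  rewrite H. ring.
Qed.

(** Let rho tend to 0.  For a < 1 the factor rho^(1-a) kills the circle and the
    rays give the reflection formula.  For a = 1 the rays cancel and the circle
    integral is constant in rho, hence equal to its value 2 pi at rho = 0. *)
Lemma hankel_sum_window (a rho : R) : 0 < a <= 1 -> 0 < rho -> hankel_sum a rho = 2 * PI / Gamma a.
Proof.
  intros [Ha [Ha1|Ha1]] Hr.
  - assert (Hc : filterlim (hankel_sum a) (at_right 0) (locally (hankel_sum a rho))).
    { apply filterlim_ext_loc with (fun _ => hankel_sum a rho).
      apply at_right_pos. intros e He. now apply hankel_sum_const. apply filterlim_const. }
    assert (Hl : filterlim (hankel_sum a) (at_right 0)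
      (locally (0 * circle_integral (1 - a) 0 + 2 * sin (PI * a) * Gamma_euler (1 - a)))).
    { apply (lim_plus (at_right 0)).
      - apply (lim_mult (at_right 0)). apply Rpower_lim_0; lra.
        apply (at_right_continuous (circle_integral (1 - a)) 0).
        apply (ex_derive_continuous (circle_integral (1 - a))). eexists. apply circle_integral_derive.
      - apply (lim_scal (at_right 0)). apply upper_gamma_lim. lra. }
    rewrite (filterlim_locally_unique _ _ _ Hc Hl).
    rewrite Gamma_pos_eq by auto.
    pose proof (Gamma_euler_pos a Ha). pose proof (Gamma_euler_reflection a ltac:(lra)) as E.
    rewrite <- E at 2. field. lra.
  - subst a. unfold hankel_sum. replace (1 - 1) with 0 by ring.
    rewrite Rmult_1_r, sin_PI, Rpower_O by auto.
    rewrite Gamma_pos_eq, Gamma_euler_1 by lra.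
    assert (K : circle_integral 0 rho = circle_integral 0 0).
    { symmetry. apply (eq_is_derive (circle_integral 0)); auto. intros t Ht.
      assert (E : circle_integral (0 + 1) t = 0).
      { destruct (Req_dec t 0) as [->|Hne].
        - apply is_RInt_unique. apply (is_RInt_ext cos).
          + intros u _. rewrite !Rmult_0_l, exp_0. rewrite Rmult_1_l. f_equal. ring.
          + evar_last. apply (is_RInt_derive sin cos).
            * intros u _. auto_derive. exact I. ring.
            * intros u _. apply continuous_cos.
            * change (sin PI - sin (- PI) = 0). rewrite sin_neg, sin_PI. ring.
        - pose proof (circle_integral_rec 0 t) as H. rewrite !Rmult_0_l, sin_0 in H.
          apply Rmult_eq_reg_l with t; auto. lra. }
      evar_last. apply circle_integral_derive. exact E. }
    rewrite K. replace (circle_integral 0 0) with (2 * PI).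
    field. symmetry. apply is_RInt_unique. apply (is_RInt_ext (fun _ => 1)).
    + intros u _. rewrite !Rmult_0_l, exp_0, Rplus_0_r, cos_0. simpl. ring.
    + evar_last. apply (@is_RInt_const R_NormedModule). unfold scal; simpl; unfold mult; simpl. ring.
Qed.

(** The recurrence carries the window (0, 1] down to all smaller [a], and up to
    all larger ones because a - 1 is then not 0. *)
Lemma hankel_sum_eq (a rho : R) : 0 < rho -> hankel_sum a rho = 2 * PI / Gamma a.
Proof.
  intros Hr. unfold Rdiv.
  assert (Down : forall n a, 0 < a + INR n <= 1 -> hankel_sum a rho = 2 * PI * / Gamma a).
  { induction n as [|n IH]; intros c Hc.
    - simpl in Hc. rewrite Rplus_0_r in Hc. now apply hankel_sum_window.
    - rewrite S_INR in Hc. rewrite Rinv_Gamma_rec.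
      replace c with (c + 1 - 1) at 1 by ring. rewrite hankel_sum_rec by auto.
      rewrite (IH (c + 1)) by lra. ring. }
  assert (Up : forall n a, 0 < a - INR n <= 1 -> hankel_sum a rho = 2 * PI * / Gamma a).
  { induction n as [|n IH]; intros c Hc.
    - simpl in Hc. rewrite Rminus_0_r in Hc. now apply hankel_sum_window.
    - rewrite S_INR in Hc. pose proof (pos_INR n).
      pose proof (hankel_sum_rec c rho Hr) as E. rewrite (IH (c - 1)) in E by lra.
      rewrite Rinv_Gamma_rec in E. replace (c - 1 + 1) with c in E by ring.
      apply Rmult_eq_reg_l with (c - 1); [|lra]. rewrite <- E. ring. }
  (* a + up (- a) lies in (0, 1]; the sign of up (- a) decides the direction *)
  destruct (archimed (- a)) as [Hz1 Hz2].
  destruct (Z.le_ge_cases 0 (up (- a))) as [Hz|Hz].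
  - apply (Down (Z.to_nat (up (- a)))). rewrite INR_IZR_INZ, Z2Nat.id by auto. lra.
  - apply (Up (Z.to_nat (- up (- a)))). rewrite INR_IZR_INZ, Z2Nat.id, opp_IZR by lia. lra.
Qed.

(** * Complex limits and integrals, componentwise *)

Lemma C_ext (a b : C) : fst a = fst b -> snd a = snd b -> a = b.
Proof. destruct a, b; simpl. now intros -> ->. Qed.

Lemma lim_C_pair {T} (F : (T -> Prop) -> Prop) {FF : Filter F} (f : T -> C) (l : C) :
  filterlim (fun t => fst (f t)) F (locally (fst l)) ->
  filterlim (fun t => snd (f t)) F (locally (snd l)) ->
  filterlim f F (locally l).
Proof.
  intros H1 H2. apply filterlim_locally. intros eps.
  pose proof (proj1 (filterlim_locally _ _) H1 eps) as K1.
  pose proof (proj1 (filterlim_locally _ _) H2 eps) as K2.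
  generalize (filter_and _ _ K1 K2). apply filter_imp. intros t [A B]. now split.
Qed.

Lemma lim_C_fst {T} (F : (T -> Prop) -> Prop) {FF : Filter F} (f : T -> C) (l : C) :
  filterlim f F (locally l) -> filterlim (fun t => fst (f t)) F (locally (fst l)).
Proof.
  intros H. apply filterlim_locally. intros eps.
  generalize (proj1 (filterlim_locally _ _) H eps). apply filter_imp. intros t [A _]. exact A.
Qed.

Lemma lim_C_snd {T} (F : (T -> Prop) -> Prop) {FF : Filter F} (f : T -> C) (l : C) :
  filterlim f F (locally l) -> filterlim (fun t => snd (f t)) F (locally (snd l)).
Proof.
  intros H. apply filterlim_locally. intros eps.
  generalize (proj1 (filterlim_locally _ _) H eps). apply filter_imp. intros t [_ A]. exact A.
Qed.

Lemma lim_C_plus {T} (F : (T -> Prop) -> Prop) {FF : Filter F} (f g : T -> C) (a b : C) :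
  filterlim f F (locally a) -> filterlim g F (locally b) ->
  filterlim (fun t => (f t + g t)%C) F (locally (a + b)%C).
Proof.
  intros Hf Hg. apply lim_C_pair; auto; simpl; apply lim_plus; auto using lim_C_fst, lim_C_snd.
Qed.

Lemma lim_C_mult {T} (F : (T -> Prop) -> Prop) {FF : Filter F} (f g : T -> C) (a b : C) :
  filterlim f F (locally a) -> filterlim g F (locally b) ->
  filterlim (fun t => (f t * g t)%C) F (locally (a * b)%C).
Proof.
  intros Hf Hg. apply lim_C_pair; auto; simpl.
  - apply lim_plus; auto. apply lim_mult; auto using lim_C_fst, lim_C_snd.
    apply filterlim_ext with (fun t => -1 * (snd (f t) * snd (g t))). intros t; ring.
    replace (- (snd a * snd b)) with (-1 * (snd a * snd b)) by ring.
    apply lim_scal; auto. apply lim_mult; auto using lim_C_fst, lim_C_snd.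
  - apply lim_plus; auto; apply lim_mult; auto using lim_C_fst, lim_C_snd.
Qed.

Notation is_RInt_gen_C f Fa Fb l := (is_RInt_gen (V := C_R_NormedModule) f Fa Fb l).

Lemma is_RInt_gen_C_pair {Fa Fb : (R -> Prop) -> Prop} {FFa : Filter Fa} {FFb : Filter Fb}
    (f : R -> C) (l : C) :
  is_RInt_gen (fun t => fst (f t)) Fa Fb (fst l) ->
  is_RInt_gen (fun t => snd (f t)) Fa Fb (snd l) ->
  is_RInt_gen_C f Fa Fb l.
Proof.
  intros H1 H2 P [eps HP].
  assert (B1 : locally (fst l) (ball (fst l) eps)) by apply locally_ball.
  assert (B2 : locally (snd l) (ball (snd l) eps)) by apply locally_ball.
  specialize (H1 _ B1). specialize (H2 _ B2).
  unfold filtermapi in *. generalize (filter_and _ _ H1 H2). apply filter_imp.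
  intros ab [[a [Ha Pa]] [b [Hb Pb]]]. exists (a, b). split.
  - exact (is_RInt_fct_extend_pair (U := R_NormedModule) (V := R_NormedModule) f _ _ _ _ Ha Hb).
  - apply HP. now split.
Qed.

Lemma is_RInt_gen_C_fst {Fa Fb : (R -> Prop) -> Prop} {FFa : Filter Fa} {FFb : Filter Fb}
    (f : R -> C) (l : C) :
  is_RInt_gen_C f Fa Fb l -> is_RInt_gen (fun t => fst (f t)) Fa Fb (fst l).
Proof.
  intros H P [eps HP].
  assert (B : locally (T := C_R_NormedModule) l (fun z => P (fst z))).
  { exists eps. intros z [Hz _]. now apply HP. }
  specialize (H _ B). unfold filtermapi in *. revert H. apply filter_imp.
  intros ab [z [Hz Pz]]. exists (fst z). split; auto.
  exact (is_RInt_fct_extend_fst (U := R_NormedModule) (V := R_NormedModule) f _ _ _ Hz).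
Qed.

Lemma is_RInt_gen_C_snd {Fa Fb : (R -> Prop) -> Prop} {FFa : Filter Fa} {FFb : Filter Fb}
    (f : R -> C) (l : C) :
  is_RInt_gen_C f Fa Fb l -> is_RInt_gen (fun t => snd (f t)) Fa Fb (snd l).
Proof.
  intros H P [eps HP].
  assert (B : locally (T := C_R_NormedModule) l (fun z => P (snd z))).
  { exists eps. intros z [_ Hz]. now apply HP. }
  specialize (H _ B). unfold filtermapi in *. revert H. apply filter_imp.
  intros ab [z [Hz Pz]]. exists (snd z). split; auto.
  exact (is_RInt_fct_extend_snd (U := R_NormedModule) (V := R_NormedModule) f _ _ _ Hz).
Qed.

Lemma is_RInt_gen_C_plus {Fa Fb : (R -> Prop) -> Prop} {FFa : Filter Fa} {FFb : Filter Fb}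
    (f g : R -> C) (a b : C) :
  is_RInt_gen_C f Fa Fb a -> is_RInt_gen_C g Fa Fb b ->
  is_RInt_gen_C (fun t => (f t + g t)%C) Fa Fb (a + b)%C.
Proof. intros Hf Hg. exact (is_RInt_gen_plus (V := C_R_NormedModule) f g a b Hf Hg). Qed.

Lemma is_RInt_gen_C_scal {Fa Fb : (R -> Prop) -> Prop} {FFa : Filter Fa} {FFb : Filter Fb}
    (c : C) (f : R -> C) (a : C) :
  is_RInt_gen_C f Fa Fb a -> is_RInt_gen_C (fun t => (c * f t)%C) Fa Fb (c * a)%C.
Proof.
  intros Hf. apply is_RInt_gen_C_pair; simpl.
  - apply (is_RInt_gen_minus (V := R_NormedModule) (fun t => fst c * fst (f t)) (fun t => snd c * snd (f t)));
      apply (is_RInt_gen_scal (V := R_NormedModule)); auto using is_RInt_gen_C_fst, is_RInt_gen_C_snd.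
  - apply (is_RInt_gen_plus (V := R_NormedModule) (fun t => fst c * snd (f t)) (fun t => snd c * fst (f t)));
      apply (is_RInt_gen_scal (V := R_NormedModule)); auto using is_RInt_gen_C_fst, is_RInt_gen_C_snd.
Qed.

Lemma is_RInt_gen_RtoC {Fa Fb : (R -> Prop) -> Prop} {FFa : Filter Fa} {FFb : Filter Fb}
    (c : C) (g : R -> R) (l : R) :
  is_RInt_gen g Fa Fb l -> is_RInt_gen_C (fun t => (c * RtoC (g t))%C) Fa Fb (c * RtoC l)%C.
Proof.
  intros Hg. apply is_RInt_gen_C_scal. apply is_RInt_gen_C_pair; simpl; auto.
  pose proof (is_RInt_gen_scal (V := R_NormedModule) g 0 l Hg) as H.
  change (is_RInt_gen (V := R_NormedModule) (fun t => 0 * g t) Fa Fb (0 * l)) in H.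
  rewrite Rmult_0_l in H.
  revert H. apply is_RInt_gen_ext. apply filter_forall. intros ab t _. apply Rmult_0_l.
Qed.

Lemma is_RInt_gen_C_ext_infty (e : R) (f g : R -> C) (l : C) :
  (forall u, e < u -> f u = g u) ->
  is_RInt_gen_C f (at_point e) (Rbar_locally p_infty) l ->
  is_RInt_gen_C g (at_point e) (Rbar_locally p_infty) l.
Proof.
  intros H. apply is_RInt_gen_ext.
  exists (fun a => a = e) (fun b => e <= b). reflexivity. apply filter_infty_ge.
  intros a b -> Hb u. simpl. rewrite Rmin_left, Rmax_right by lra. intros Hu. apply H. lra.
Qed.

(** * Hankel's formula, complex form *)

Lemma is_hankel_plus (rho : R) (f g : polar -> C) (a b : C) :
  is_hankel rho f a -> is_hankel rho g b ->
  is_hankel rho (fun w => (f w + g w)%C) (a + b)%C.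
Proof.
  intros (l1 & c1 & u1 & L1 & C1 & U1 & ->) (l2 & c2 & u2 & L2 & C2 & U2 & ->).
  exists (l1 + l2)%C, (c1 + c2)%C, (u1 + u2)%C. repeat split.
  - apply is_RInt_gen_C_ext_infty with (2 := is_RInt_gen_C_plus _ _ _ _ L1 L2). intros; ring.
  - apply (is_RInt_ext (V := C_R_NormedModule)) with (2 := is_RInt_plus (V := C_R_NormedModule) _ _ _ _ _ _ C1 C2).
    intros t _. change (f (rho, t) * (Ci * RtoC rho * cis t) + g (rho, t) * (Ci * RtoC rho * cis t) = (f (rho, t) + g (rho, t)) * (Ci * RtoC rho * cis t))%C. ring.
  - apply is_RInt_gen_C_ext_infty with (2 := is_RInt_gen_C_plus _ _ _ _ U1 U2). intros; ring.
  - ring.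
Qed.

Lemma is_hankel_scal (rho : R) (k : C) (f : polar -> C) (a : C) :
  is_hankel rho f a -> is_hankel rho (fun w => (k * f w)%C) (k * a)%C.
Proof.
  intros (l1 & c1 & u1 & L1 & C1 & U1 & ->).
  exists (k * l1)%C, (k * c1)%C, (k * u1)%C. repeat split.
  - apply is_RInt_gen_C_ext_infty with (2 := is_RInt_gen_C_scal k _ _ L1). intros; ring.
  - apply is_RInt_gen_at_point. apply is_RInt_gen_at_point in C1.
    apply (is_RInt_gen_C_scal k) in C1. revert C1. apply is_RInt_gen_ext.
    apply filter_forall. intros ab t _. simpl. ring.
  - apply is_RInt_gen_C_ext_infty with (2 := is_RInt_gen_C_scal k _ _ U1). intros; ring.
  - ring.
Qed.

Lemma RtoC_mult_pair (r a b : R) : (RtoC r * (a, b))%C = (r * a, r * b).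
Proof. apply C_ext; simpl; ring. Qed.

Lemma is_RInt_odd (f : R -> R) (a l : R) :
  (forall t, f (- t) = - f t) -> is_RInt f (- a) a l -> l = 0.
Proof.
  intros Hodd H.
  assert (H1 : is_RInt f a (- a) l).
  { apply (is_RInt_ext (fun y => opp (f (- y)))).
    - intros t _. rewrite Hodd. apply Ropp_involutive.
    - apply (is_RInt_comp_opp (V := R_NormedModule)). now rewrite Ropp_involutive. }
  apply is_RInt_swap in H1. unfold opp in H1; simpl in H1.
  pose proof (is_RInt_unique _ _ _ _ H) as E1. pose proof (is_RInt_unique _ _ _ _ H1) as E2.
  rewrite E1 in E2. lra.
Qed.

Definition hankel_term (a : R) (w : polar) : C := (cexp (pt w) * ppow w a)%C.

Lemma cis_opp_PI : cis (- PI) = RtoC (-1).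
Proof. unfold cis. rewrite cos_neg, sin_neg, cos_PI, sin_PI. apply C_ext; simpl; ring. Qed.

Lemma cis_PI : cis PI = RtoC (-1).
Proof. unfold cis. rewrite cos_PI, sin_PI. reflexivity. Qed.

(** On both rays w = -r, so only the phase of w^(-a) distinguishes them. *)
Lemma hankel_term_ray (a r t : R) : cis t = RtoC (-1) ->
  (hankel_term (- a) (r, t) * cis t)%C = (- cis (- a * t) * RtoC (gamma_density (1 - a) r))%C.
Proof.
  intros Ht. unfold hankel_term, pt, ppow, fst, snd. rewrite Ht.
  replace (RtoC r * RtoC (-1))%C with (RtoC (- r)) by (apply C_ext; simpl; ring).
  replace (cexp (RtoC (- r))) with (RtoC (exp (- r))).
  2: { unfold cexp, cis. simpl. rewrite cos_0, sin_0. apply C_ext; simpl; ring. }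
  unfold gamma_density. replace (1 - a - 1) with (- a) by ring.
  rewrite RtoC_mult. replace (RtoC (-1)) with (- (1))%C by (apply C_ext; simpl; ring).
  ring.
Qed.

(** The real part of the circle integrand is odd in the angle, and the two rays
    have conjugate values up to sign, so the result is i times [hankel_sum]. *)
Lemma is_hankel_term (a rho : R) : 0 < rho ->
  is_hankel rho (hankel_term (- a)) (2 * RtoC PI * Ci * RtoC (/ Gamma a))%C.
Proof.
  intros Hr. set (U := upper_gamma (1 - a) rho).
  exists (- cis (- a * - PI) * RtoC U)%C,
    (0, Rpower rho (1 - a) * circle_integral (1 - a) rho),
    (- cis (- a * PI) * RtoC U)%C.
  repeat split.
  - apply is_RInt_gen_C_ext_infty with (fun r => (- cis (- a * - PI) * RtoC (gamma_density (1 - a) r))%C).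
    + intros r _. symmetry. apply hankel_term_ray, cis_opp_PI.
    + apply (is_RInt_gen_RtoC (Fa := at_point rho) (Fb := Rbar_locally p_infty)). now apply upper_gamma_correct.
  - set (th := fun t => rho * sin t + (1 - a) * t).
    assert (E : forall t, (hankel_term (- a) (rho, t) * (Ci * RtoC rho * cis t))%C =
      (Rpower rho (1 - a) * - (exp (rho * cos t) * sin (th t)),
       Rpower rho (1 - a) * (exp (rho * cos t) * cos (th t)))).
    { intros t. unfold hankel_term, ppow, cexp.
      replace (pt (rho, t)) with (rho * cos t, rho * sin t) by (symmetry; apply RtoC_mult_pair).
      unfold Re, Im, fst, snd.
      replace (Rpower rho (1 - a)) with (Rpower rho (- a) * rho).
      2: { rewrite <- (Rpower_1 rho) at 2 by auto. rewrite <- Rpower_plus. f_equal. ring. }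
      replace (th t) with (rho * sin t + (- a * t) + t) by (unfold th; ring).
      unfold cis. rewrite !sin_plus, !cos_plus, ?sin_plus. apply C_ext; simpl; ring. }
    apply (is_RInt_ext (V := C_R_NormedModule) (fun t => (Rpower rho (1 - a) * - (exp (rho * cos t) * sin (th t)),
       Rpower rho (1 - a) * (exp (rho * cos t) * cos (th t))) : C)).
    { intros t _. symmetry. apply E. }
    apply (is_RInt_fct_extend_pair (U := R_NormedModule) (V := R_NormedModule)); cbv [fst snd].
    + set (f := fun t => Rpower rho (1 - a) * - (exp (rho * cos t) * sin (th t))).
      assert (Hf : ex_RInt f (- PI) PI).
      { apply (@ex_RInt_continuous R_CompleteNormedModule). intros t _.
        apply (ex_derive_continuous (fun t : R => Rpower rho (1 - a) * - (exp (rho * cos t) * sin (rho * sin t + (1 - a) * t)))).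
        auto_derive. exact I. }
      destruct Hf as [l Hl]. replace 0 with l; auto.
      apply (is_RInt_odd f PI); auto. intros t. unfold f, th. rewrite cos_neg, sin_neg.
      replace (rho * - sin t + (1 - a) * - t) with (- (rho * sin t + (1 - a) * t)) by ring.
      rewrite sin_neg. ring.
    + apply (is_RInt_scal (V := R_NormedModule)). apply circle_integral_correct.
  - apply is_RInt_gen_C_ext_infty with (fun r => (- cis (- a * PI) * RtoC (gamma_density (1 - a) r))%C).
    + intros r _. symmetry. apply hankel_term_ray, cis_PI.
    + apply (is_RInt_gen_RtoC (Fa := at_point rho) (Fb := Rbar_locally p_infty)). now apply upper_gamma_correct.
  - pose proof (hankel_sum_eq a rho Hr) as H. unfold hankel_sum in H. fold U in H.
    unfold Rdiv in H.
    replace (- a * - PI) with (PI * a) by ring. replace (- a * PI) with (- (PI * a)) by ring.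
    unfold cis. rewrite cos_neg, sin_neg. apply C_ext; simpl.
    + ring.
    + transitivity (2 * PI * / Gamma a). ring. rewrite <- H. ring.
Qed.

(** * Finite parts of Gamma integrals *)

Fixpoint exp_opp_poly (m : nat) (e : R) : R :=
  match m with
  | O => 0
  | S n => exp_opp_poly n e + (- e) ^ n / INR (fact n)
  end.

Lemma exp_opp_poly_derive (m : nat) (e : R) :
  is_derive (exp_opp_poly (S m)) e (- exp_opp_poly m e).
Proof.
  induction m as [|m IH].
  - simpl. apply is_derive_ext with (fun _ => 1). intros t. simpl. field.
    rewrite Ropp_0. apply (@is_derive_const R_AbsRing R_NormedModule).
  - apply (is_derive_ext (fun e => exp_opp_poly (S m) e + (- e) ^ S m / INR (fact (S m)))).
    reflexivity.
    replace (- exp_opp_poly (S m) e)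
      with (plus (- exp_opp_poly m e) (- ((- e) ^ m / INR (fact m)))).
    + apply (is_derive_plus (exp_opp_poly (S m)) (fun e => (- e) ^ S m / INR (fact (S m)))).
      exact IH. auto_derive. exact I.
      change (match m with O => 1 | S _ => INR m + 1 end) with (INR (S m)).
      change (fact m + m * fact m)%nat with (fact (S m)).
      rewrite fact_simpl, mult_INR. change (pred (S m)) with m.
      field. split. apply INR_fact_neq_0. apply not_0_INR. lia.
    + unfold plus; simpl. ring.
Qed.

(** The remainder with [m + 1] terms vanishes at 0 and its derivative is minus the
    remainder with [m] terms, so the mean value theorem gains a factor [e]. *)
Lemma exp_opp_taylor (m : nat) (e : R) : 0 <= e -> Rabs (exp (- e) - exp_opp_poly m e) <= e ^ m.
Proof.
  revert e. induction m as [|m IH]; intros e He.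
  - simpl. rewrite Rminus_0_r, Rabs_pos_eq by apply Rlt_le, exp_pos.
    rewrite <- exp_0. apply exp_le_compat. lra.
  - set (r := fun n t => exp (- t) - exp_opp_poly n t).
    assert (Hd : forall t, is_derive (r (S m)) t (- r m t)).
    { intros t. unfold r. evar_last.
      apply (is_derive_minus (fun t => exp (- t)) (exp_opp_poly (S m))).
      auto_derive. exact I. reflexivity. apply exp_opp_poly_derive.
      unfold minus, plus, opp; simpl. ring. }
    assert (H0 : r (S m) 0 = 0).
    { unfold r. rewrite Ropp_0, exp_0.
      replace (exp_opp_poly (S m) 0) with 1. ring.
      clear. induction m as [|m IH]. simpl. field.
      change (1 = exp_opp_poly (S m) 0 + (- 0) ^ S m / INR (fact (S m))).
      rewrite <- IH. simpl ((- 0) ^ S m). unfold Rdiv. ring. }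
    destruct (MVT_gen (r (S m)) 0 e (fun t => - r m t)) as [c [Hc E]].
    + intros t _. apply Hd.
    + intros t _. apply derivable_continuous_pt. exists (- r m t). apply is_derive_Reals, Hd.
    + rewrite Rmin_left, Rmax_right in Hc by auto.
      change (Rabs (r (S m) e) <= e ^ S m).
      rewrite H0 in E. replace (r (S m) e) with (- r m c * e) by lra.
      rewrite Rabs_mult, Rabs_Ropp, (Rabs_pos_eq e) by auto. simpl. rewrite Rmult_comm.
      apply Rmult_le_compat_l; auto. apply Rle_trans with (c ^ m).
      apply IH. lra. apply pow_incr. lra.
Qed.

(** The logarithm-free real case of [singular_part]. *)
Definition pole_part (cs : list (R * R)) (e : R) : R :=
  List.fold_right (fun ac acc => snd ac * Rpower e (- fst ac) + acc) 0 cs.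

Definition pole_scal (k : R) (cs : list (R * R)) : list (R * R) :=
  List.map (fun ac => (fst ac, k * snd ac)) cs.

Lemma pole_part_app (cs1 cs2 : list (R * R)) (e : R) :
  pole_part (cs1 ++ cs2) e = pole_part cs1 e + pole_part cs2 e.
Proof. induction cs1 as [|ac cs IH]; simpl. ring. unfold pole_part in *. rewrite IH. ring. Qed.

Lemma pole_part_scal (k : R) (cs : list (R * R)) (e : R) :
  pole_part (pole_scal k cs) e = k * pole_part cs e.
Proof. induction cs as [|ac cs IH]; simpl. ring. unfold pole_part in *. rewrite IH. ring. Qed.

Lemma Forall_pole_scal (k : R) (cs : list (R * R)) :
  Forall (fun ac => 0 < fst ac) cs -> Forall (fun ac => 0 < fst ac) (pole_scal k cs).
Proof. intros H. apply List.Forall_map. exact H. Qed.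

Lemma not_integer_neq (x : R) (n : nat) : ~ is_integer x -> x + INR n <> 0.
Proof.
  intros Hx E. apply Hx. exists (- Z.of_nat n)%Z. rewrite opp_IZR, <- INR_IZR_INZ. lra.
Qed.

(** The powers e^(x+j) with x + j < 0 are put into the singular part, and those
    with x + j > 0 tend to 0; x + j = 0 would leave a constant. *)
Lemma exp_poly_finite_part (x : R) (m : nat) : ~ is_integer x ->
  exists cs, Forall (fun ac => 0 < fst ac) cs /\
    filterlim (fun e => exp_opp_poly m e * Rpower e x - pole_part cs e) (at_right 0) (locally 0).
Proof.
  intros Hx. induction m as [|m [cs [Hcs Hl]]].
  - exists nil. split. constructor. simpl. apply filterlim_ext with (fun _ => 0).
    intros e. ring. apply filterlim_const.
  - assert (Ht : forall e, 0 < e -> (- e) ^ m / INR (fact m) * Rpower e x =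
      ((-1) ^ m / INR (fact m)) * Rpower e (x + INR m)).
    { intros e He. rewrite Rpower_plus, Rpower_pow by auto.
      replace (- e) with (-1 * e) by ring. rewrite Rpow_mult_distr. field. apply INR_fact_neq_0. }
    destruct (Rtotal_order (x + INR m) 0) as [Hm|[Hm|Hm]].
    + exists ((- (x + INR m), (-1) ^ m / INR (fact m)) :: cs). split.
      * constructor; auto. simpl. lra.
      * apply filterlim_ext_loc with (2 := Hl). apply at_right_pos. intros e He.
        simpl. rewrite Ropp_involutive. rewrite Rmult_plus_distr_r, Ht by auto.
        fold (pole_part cs e). ring.
    + exfalso. revert Hm. now apply not_integer_neq.
    + exists cs. split; auto.
      apply filterlim_ext_loc with (fun e => exp_opp_poly m e * Rpower e x - pole_part cs e
        + ((-1) ^ m / INR (fact m)) * Rpower e (x + INR m)).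
      * apply at_right_pos. intros e He. simpl. rewrite <- Ht by auto. ring.
      * apply (lim_eq _ _ (0 + ((-1) ^ m / INR (fact m)) * 0)); [|ring].
        apply (lim_plus (at_right 0)); auto.
        apply (lim_scal (at_right 0)). now apply Rpower_lim_0.
Qed.

Lemma lim_dominated (f g : R -> R) :
  (forall e, 0 < e -> Rabs (f e) <= g e) ->
  filterlim g (at_right 0) (locally 0) -> filterlim f (at_right 0) (locally 0).
Proof.
  intros H Hg. apply filterlim_locally. intros eps.
  generalize (filter_and _ _ (proj1 (filterlim_locally _ _) Hg eps)
    (at_right_pos (fun e => 0 < e) (fun e He => He))).
  apply filter_imp. intros e [Hb He]. specialize (H e He).
  change (Rabs (g e - 0) < eps) in Hb. change (Rabs (f e - 0) < eps).
  rewrite Rminus_0_r in *. apply Rabs_def2 in Hb. lra.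
Qed.

Lemma boundary_finite_part (x : R) : ~ is_integer x ->
  exists cs, Forall (fun ac => 0 < fst ac) cs /\
    filterlim (fun e => exp (- e) * Rpower e x - pole_part cs e) (at_right 0) (locally 0).
Proof.
  intros Hx. set (m := Gamma_shift x).
  destruct (exp_poly_finite_part x m Hx) as [cs [Hcs Hl]].
  exists cs. split; auto.
  apply filterlim_ext with (fun e => (exp_opp_poly m e * Rpower e x - pole_part cs e)
    + (exp (- e) - exp_opp_poly m e) * Rpower e x). intros e. ring.
  apply (lim_eq _ _ (0 + 0)); [|ring]. apply (lim_plus (at_right 0)); auto.
  apply lim_dominated with (fun e => Rpower e (x + INR m)).
  - intros e He. rewrite Rabs_mult, (Rabs_pos_eq (Rpower e x)) by apply Rpower_ge0.
    rewrite Rpower_plus, Rpower_pow, Rmult_comm by auto.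
    apply Rmult_le_compat_l. apply Rpower_ge0. apply exp_opp_taylor. lra.
  - apply Rpower_lim_0, Gamma_shift_pos.
Qed.

(** Downward induction from positive arguments: solving the recurrence for
    U (x, e), the boundary term contributes only negative powers. *)
Lemma upper_gamma_finite_part (x : R) : ~ is_integer x ->
  exists cs, Forall (fun ac => 0 < fst ac) cs /\
    filterlim (fun e => upper_gamma x e - pole_part cs e) (at_right 0) (locally (Gamma x)).
Proof.
  assert (K : forall n x, ~ is_integer x -> 0 < x + INR n ->
    exists cs, Forall (fun ac => 0 < fst ac) cs /\
    filterlim (fun e => upper_gamma x e - pole_part cs e) (at_right 0) (locally (Gamma x))).
  2: { intros Hx. apply (K (Gamma_shift x)); auto. apply Gamma_shift_pos. }
  clear x. induction n as [|n IH]; intros x Hx Hn.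
  - simpl in Hn. rewrite Rplus_0_r in Hn. exists nil. split. constructor.
    rewrite Gamma_pos_eq by auto. apply filterlim_ext with (upper_gamma x).
    intros e. simpl. ring. now apply upper_gamma_lim.
  - destruct (IH (x + 1)) as [cs1 [H1 L1]].
    + now apply (not_integer_shift x 1).
    + rewrite S_INR in Hn. lra.
    + destruct (boundary_finite_part x Hx) as [cs2 [H2 L2]].
      assert (Hx0 : x <> 0).
      { pose proof (not_integer_neq x 0 Hx) as H. simpl in H. rewrite Rplus_0_r in H. exact H. }
      exists (pole_scal (/ x) (cs1 ++ pole_scal (-1) cs2)). split.
      * apply Forall_pole_scal. apply Forall_app. split; auto. now apply Forall_pole_scal.
      * apply filterlim_ext_loc with (fun e => / x * (upper_gamma (x + 1) e - pole_part cs1 e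
          + -1 * (exp (- e) * Rpower e x - pole_part cs2 e))).
        -- apply at_right_pos. intros e He.
           rewrite pole_part_scal, pole_part_app, pole_part_scal, upper_gamma_rec by auto.
           field. auto.
        -- replace (Gamma x) with (/ x * (Gamma (x + 1) + -1 * 0)).
           2: { rewrite Gamma_rec by auto. field. auto. }
           apply (lim_scal (at_right 0)). apply (lim_plus (at_right 0)); auto.
           now apply (lim_scal (at_right 0)).
Qed.

Lemma singular_part_app (d1 d2 : C) (cs1 cs2 : list (R * C)) (e : R) :
  singular_part (d1 + d2)%C (cs1 ++ cs2) e = (singular_part d1 cs1 e + singular_part d2 cs2 e)%C.
Proof.
  unfold singular_part.
  assert (H : fold_right (fun (ac : R * C) (acc : C) => (snd ac * RtoC (Rpower e (- fst ac)) + acc)%C) (RtoC 0) (cs1 ++ cs2)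
    = (fold_right (fun (ac : R * C) (acc : C) => (snd ac * RtoC (Rpower e (- fst ac)) + acc)%C) (RtoC 0) cs1
    + fold_right (fun (ac : R * C) (acc : C) => (snd ac * RtoC (Rpower e (- fst ac)) + acc)%C) (RtoC 0) cs2)%C).
  { induction cs1 as [|ac cs IH]; simpl. ring. rewrite IH. ring. }
  rewrite H. ring.
Qed.

Lemma singular_part_scal (k d : C) (cs : list (R * C)) (e : R) :
  singular_part (k * d)%C (map (fun ac => (fst ac, (k * snd ac)%C)) cs) e = (k * singular_part d cs e)%C.
Proof.
  unfold singular_part. rewrite Cmult_plus_distr_l. f_equal. ring.
  induction cs as [|ac cs IH]; simpl. ring. rewrite IH. ring.
Qed.

Lemma is_fp_integral_plus (f g : R -> C) (a b : C) :
  is_fp_integral f a -> is_fp_integral g b -> is_fp_integral (fun u => (f u + g u)%C) (a + b)%C.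
Proof.
  intros (J1 & d1 & cs1 & I1 & F1 & L1) (J2 & d2 & cs2 & I2 & F2 & L2).
  exists (fun e => (J1 e + J2 e)%C), (d1 + d2)%C, (cs1 ++ cs2). repeat split.
  - intros e He. apply is_RInt_gen_C_plus; auto.
  - apply Forall_app. now split.
  - apply filterlim_ext with (fun e => ((J1 e - singular_part d1 cs1 e) + (J2 e - singular_part d2 cs2 e))%C).
    intros e. rewrite singular_part_app. ring.
    now apply (lim_C_plus (at_right 0)).
Qed.

Lemma is_fp_integral_scal (k : C) (f : R -> C) (a : C) :
  is_fp_integral f a -> is_fp_integral (fun u => (k * f u)%C) (k * a)%C.
Proof.
  intros (J1 & d1 & cs1 & I1 & F1 & L1).
  exists (fun e => (k * J1 e)%C), (k * d1)%C, (map (fun ac => (fst ac, (k * snd ac)%C)) cs1). repeat split.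
  - intros e He. apply is_RInt_gen_C_scal; auto.
  - apply List.Forall_map. exact F1.
  - apply filterlim_ext with (fun e => (k * (J1 e - singular_part d1 cs1 e))%C).
    intros e. rewrite singular_part_scal. ring.
    apply (lim_C_mult (at_right 0)); auto. apply filterlim_const.
Qed.

Lemma is_fp_integral_ext (f g : R -> C) (a : C) :
  (forall u, 0 < u -> f u = g u) -> is_fp_integral f a -> is_fp_integral g a.
Proof.
  intros H (J1 & d1 & cs1 & I1 & F1 & L1). exists J1, d1, cs1. repeat split; auto.
  intros e He. apply is_RInt_gen_C_ext_infty with (2 := I1 e He). intros u Hu. apply H. lra.
Qed.

Lemma is_fp_integral_gamma (x : R) : ~ is_integer x ->
  is_fp_integral (fun u => RtoC (gamma_density x u)) (RtoC (Gamma x)).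
Proof.
  intros Hx. destruct (upper_gamma_finite_part x Hx) as [cs [Hcs Hl]].
  exists (fun e => RtoC (upper_gamma x e)), (RtoC 0), (map (fun ac => (fst ac, RtoC (snd ac))) cs).
  repeat split.
  - intros e He.
    apply is_RInt_gen_C_ext_infty with (fun u => (1 * RtoC (gamma_density x u))%C). intros; ring.
    replace (RtoC (upper_gamma x e)) with (1 * RtoC (upper_gamma x e))%C by ring.
    apply is_RInt_gen_RtoC. now apply upper_gamma_correct.
  - apply List.Forall_map. exact Hcs.
  - assert (E : forall e, singular_part (RtoC 0) (map (fun ac => (fst ac, RtoC (snd ac))) cs) e = RtoC (pole_part cs e)).
    { intros e. unfold singular_part. rewrite Cmult_0_l, Cplus_0_l.
      clear. induction cs as [|ac cs IH]; simpl; auto. rewrite IH.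
      now rewrite RtoC_plus, RtoC_mult. }
    apply filterlim_ext with (fun e => RtoC (upper_gamma x e - pole_part cs e)).
    { intros e. rewrite E. now rewrite RtoC_minus. }
    apply (lim_C_pair (at_right 0)); simpl; auto. apply filterlim_const.
Qed.

Notation csum f n := (sum_n (G := C_AbelianMonoid) f n).

(** * Finite sums and the trinomial theorem *)

(** Rewriting with sums leaves equations at the carrier of an abelian monoid,
    where [ring] does not recognize the complex numbers. *)
Ltac cring := match goal with |- @eq _ ?a ?b => change (@eq C a b) end; ring.

Lemma csum_S (f : nat -> C) (n : nat) : csum f (S n) = (csum f n + f (S n))%C.
Proof. exact (sum_Sn (G := C_AbelianMonoid) f n). Qed.

Lemma csum_scal (c : C) (f : nat -> C) (n : nat) : (c * csum f n)%C = csum (fun l => (c * f l)%C) n.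
Proof.
  induction n as [|n IH]. now rewrite !sum_O.
  rewrite !csum_S, <- IH. cring.
Qed.

Lemma csum_shift (f : nat -> C) (n : nat) : csum f (S n) = (f O + csum (fun l => f (S l)) n)%C.
Proof.
  induction n as [|n IH]. rewrite csum_S, !sum_O. reflexivity.
  rewrite csum_S, IH, csum_S. cring.
Qed.

Lemma csum_plus (f g : nat -> C) (n : nat) :
  csum (fun l => (f l + g l)%C) n = (csum f n + csum g n)%C.
Proof.
  induction n as [|n IH]. now rewrite !sum_O. rewrite !csum_S, IH. cring.
Qed.

(** Finite sums pass through any additive relation between functions and values;
    the relation will be in turn a finite part, a contour integral and a limit. *)
Lemma csum_closed {X : Type} (P : (X -> C) -> C -> Prop)
  (HP : forall f g a b, P f a -> P g b -> P (fun x => (f x + g x)%C) (a + b)%C)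
  (f : nat -> X -> C) (a : nat -> C) (n : nat) :
  (forall l, (l <= n)%nat -> P (f l) (a l)) ->
  P (fun x => csum (fun l => f l x) n) (csum a n).
Proof.
  induction n as [|n IH]; intros H.
  - rewrite sum_O. replace (fun x => csum (fun l => f l x) 0) with (f O). auto.
    apply functional_extensionality. intros x. now rewrite sum_O.
  - rewrite csum_S.
    replace (fun x => csum (fun l => f l x) (S n)) with
      (fun x => (csum (fun l => f l x) n + f (S n) x)%C).
    + apply (HP (fun x => csum (fun l => f l x) n) (f (S n))); auto.
    + apply functional_extensionality. intros x. now rewrite csum_S.
Qed.

Definition triangle_sum (f : nat -> nat -> C) (k : nat) : C :=
  csum (fun l => csum (fun s => f l s) (k - l)) k.

Lemma triangle_sum_closed {X : Type} (P : (X -> C) -> C -> Prop)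
  (HP : forall f g a b, P f a -> P g b -> P (fun x => (f x + g x)%C) (a + b)%C)
  (f : nat -> nat -> X -> C) (a : nat -> nat -> C) (k : nat) :
  (forall l s, (l <= k)%nat -> P (f l s) (a l s)) ->
  P (fun x => triangle_sum (fun l s => f l s x) k) (triangle_sum a k).
Proof.
  intros H. apply (csum_closed P HP (fun l x => csum (fun s => f l s x) (k - l))).
  intros l Hl. apply (csum_closed P HP (f l)). intros s _. auto.
Qed.

Lemma triangle_sum_ext (f g : nat -> nat -> C) (k : nat) :
  (forall l s, (l <= k)%nat -> f l s = g l s) -> triangle_sum f k = triangle_sum g k.
Proof.
  intros H. apply sum_n_ext_loc. intros l Hl. apply sum_n_ext. intros s. auto.
Qed.

Lemma triangle_sum_scal (c : C) (f : nat -> nat -> C) (k : nat) :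
  (c * triangle_sum f k)%C = triangle_sum (fun l s => (c * f l s)%C) k.
Proof.
  unfold triangle_sum. rewrite csum_scal. apply sum_n_ext. intros l. apply csum_scal.
Qed.

(** The binomial coefficient, in the form that appears in the polynomials. *)
Definition binom_coef (k l : nat) : R := poch (- INR k) l * (-1) ^ l / INR (fact l).

Lemma poch_shift (a : R) (n : nat) : poch (a - 1) (S n) = (a - 1) * poch a n.
Proof.
  change (S n) with (1 + n)%nat. rewrite poch_add. simpl (poch (a - 1) 1). simpl (INR 1).
  replace (a - 1 + 1) with a by ring. ring.
Qed.

Lemma binom_coef_pascal (k l : nat) :
  binom_coef (S k) (S l) = binom_coef k (S l) + binom_coef k l.
Proof.
  unfold binom_coef. rewrite S_INR. replace (- (INR k + 1)) with (- INR k - 1) by ring.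
  rewrite poch_shift. rewrite fact_simpl, mult_INR, S_INR. simpl.
  pose proof (pos_INR l). field. split. apply INR_fact_neq_0. lra.
Qed.

Lemma binom_coef_0 (k : nat) : binom_coef k 0 = 1.
Proof. unfold binom_coef. simpl. field. Qed.

Lemma binom_coef_out (k : nat) : binom_coef k (S k) = 0.
Proof. unfold binom_coef. simpl poch. replace (- INR k + INR k) with 0 by ring. unfold Rdiv. ring. Qed.

Lemma C_binomial (A Y : C) (k : nat) :
  ((A + Y) ^ k)%C = csum (fun l => (RtoC (binom_coef k l) * Y ^ l * A ^ (k - l))%C) k.
Proof.
  induction k as [|k IH].
  - rewrite sum_O, binom_coef_0. simpl. ring.
  - rewrite Cpow_S, IH, Cmult_plus_distr_r, csum_shift.
    rewrite binom_coef_0.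
    assert (EA : (A * csum (fun l => RtoC (binom_coef k l) * Y ^ l * A ^ (k - l)) k)%C =
      csum (fun l => RtoC (binom_coef k l) * Y ^ l * A ^ (S k - l))%C (S k)).
    { rewrite csum_S, binom_coef_out, csum_scal.
      replace (RtoC 0 * Y ^ S k * A ^ (S k - S k))%C with (RtoC 0) by ring.
      rewrite Cplus_0_r. apply sum_n_ext_loc. intros l Hl.
      replace (S k - l)%nat with (S (k - l)) by lia. rewrite Cpow_S. cring. }
    rewrite EA, csum_shift, binom_coef_0, csum_scal, <- Cplus_assoc, <- csum_plus.
    f_equal. apply sum_n_ext. intros l. rewrite binom_coef_pascal, RtoC_plus, Cpow_S.
    change (S k - S l)%nat with (k - l)%nat. cring.
Qed.

(** The binomial theorem twice, with (-k)_(l+s) = (-k)_l (-(k-l))_s. *)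
Lemma C_trinomial (Y Z : C) (k : nat) :
  ((1 - Z + Y) ^ k)%C = triangle_sum (fun l s =>
    (RtoC (poch (- INR k) (l + s) / (INR (fact l) * INR (fact s))) * (- Y) ^ l * Z ^ s)%C) k.
Proof.
  rewrite C_binomial. apply sum_n_ext_loc. intros l Hl.
  replace (1 - Z)%C with (1 + - Z)%C by ring. rewrite C_binomial, csum_scal.
  apply sum_n_ext. intros s. rewrite Cpow_1_l.
  unfold binom_coef. rewrite poch_add.
  replace (- INR k + INR l) with (- INR (k - l)).
  2: { rewrite minus_INR by auto. ring. }
  replace (- Y)%C with (RtoC (-1) * Y)%C by (apply C_ext; simpl; ring).
  replace (- Z)%C with (RtoC (-1) * Z)%C by (apply C_ext; simpl; ring).
  rewrite !Cpow_mult_l, <- !RtoC_pow.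
  assert (E : (-1) ^ s * (-1) ^ s = 1) by (rewrite <- Rpow_mult_distr; replace (-1 * -1) with 1 by ring; apply pow1).
  transitivity (RtoC (poch (- INR k) l * (-1) ^ l / INR (fact l) * (poch (- INR (k - l)) s * (-1) ^ s / INR (fact s)) * (-1) ^ s) * Y ^ l * Z ^ s)%C.
  { rewrite !RtoC_mult. cring. }
  transitivity (RtoC (poch (- INR k) l * poch (- INR (k - l)) s / (INR (fact l) * INR (fact s)) * (-1) ^ l) * Y ^ l * Z ^ s)%C.
  2: { rewrite (RtoC_mult _ ((-1) ^ l)). cring. }
  do 3 f_equal. unfold Rdiv. rewrite Rinv_mult.
  transitivity (poch (- INR k) l * poch (- INR (k - l)) s * (/ INR (fact l) * / INR (fact s)) * (-1) ^ l * ((-1) ^ s * (-1) ^ s)).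
  ring. rewrite E. ring.
Qed.

(** * Powers on the Riemann surface of the logarithm *)

Lemma cis_plus (a b : R) : cis (a + b) = (cis a * cis b)%C.
Proof. unfold cis. rewrite cos_plus, sin_plus. apply C_ext; simpl; ring. Qed.

Lemma cis_0 : cis 0 = 1.
Proof. unfold cis. now rewrite cos_0, sin_0. Qed.

Lemma pt_mult_inv (w : polar) : 0 < fst w ->
  (pt w * (RtoC (/ fst w) * cis (- snd w)))%C = 1.
Proof.
  intros Hw. unfold pt.
  transitivity (RtoC (fst w * / fst w) * (cis (snd w) * cis (- snd w)))%C.
  rewrite RtoC_mult. ring. rewrite <- cis_plus, Rplus_opp_r, cis_0, Rinv_r by lra. ring.
Qed.

Lemma pt_neq0 (w : polar) : 0 < fst w -> pt w <> 0.
Proof.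
  intros Hw E. pose proof (pt_mult_inv w Hw) as H.
  rewrite E, Cmult_0_l in H. symmetry in H. now apply C1_nz in H.
Qed.

Lemma pt_inv (w : polar) : 0 < fst w -> (/ pt w)%C = (RtoC (/ fst w) * cis (- snd w))%C.
Proof.
  intros Hw. pose proof (pt_mult_inv w Hw) as H. pose proof (pt_neq0 w Hw).
  set (x := (RtoC (/ fst w) * cis (- snd w))%C) in *.
  replace x with (/ pt w * (pt w * x))%C. rewrite H. ring.
  rewrite Cmult_assoc, Cinv_l by auto. ring.
Qed.

Lemma ppow_div (w : polar) (a : R) (n : nat) : 0 < fst w ->
  (ppow w a * (/ pt w) ^ n)%C = ppow w (a - INR n).
Proof.
  intros Hw. induction n as [|n IH].
  - simpl. rewrite Rminus_0_r. ring.
  - rewrite Cpow_S. transitivity (ppow w a * (/ pt w) ^ n * / pt w)%C. ring.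
    rewrite IH, pt_inv by auto. unfold ppow.
    transitivity (RtoC (Rpower (fst w) (a - INR n) * / fst w) * (cis ((a - INR n) * snd w) * cis (- snd w)))%C.
    rewrite RtoC_mult; ring.
    rewrite <- cis_plus. rewrite S_INR. f_equal.
    + f_equal. rewrite <- (Rpower_1 (fst w)) at 2 by auto. rewrite <- Rpower_Ropp, <- Rpower_plus.
      f_equal. ring.
    + f_equal. ring.
Qed.

Lemma cexp_plus (a b : C) : cexp (a + b) = (cexp a * cexp b)%C.
Proof.
  unfold cexp. replace (Re (a + b)) with (Re a + Re b) by reflexivity.
  replace (Im (a + b)) with (Im a + Im b) by reflexivity.
  rewrite exp_plus, cis_plus, RtoC_mult. ring.
Qed.

Lemma cexp_RtoC (r : R) : cexp (RtoC r) = RtoC (exp r).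
Proof. unfold cexp. simpl. rewrite cis_0. ring. Qed.

(** * The triple integral *)

Lemma on_hankel_pos (rho : R) (w : polar) : 0 < rho -> on_hankel rho w -> 0 < fst w.
Proof. intros Hr [[-> _]|[H _]]; lra. Qed.

Definition monomial_coef (k v : nat) (y z : C) (l s : nat) : C :=
  (RtoC (poch (- INR k) (l + s) / (INR (fact l) * INR (fact s))) * (- y) ^ l * z ^ (v * s))%C.

(** Separation of variables: multiplying w^a by the integer powers of 1 / w from
    the trinomial expansion only shifts the exponents. *)
Lemma integrand_expand (k v : nat) (p q : R) (y z : C) (u : R) (w1 w2 : polar) :
  0 < u -> 0 < fst w1 -> 0 < fst w2 ->
  integrand k v p q y z u w1 w2 = triangle_sum (fun l s =>
    (monomial_coef k v y z l s * hankel_term (- (INR l + q + 1)) w1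
      * hankel_term (- (INR (v * s) - p - q + 1)) w2
      * RtoC (gamma_density (INR k + 1 - p + INR l) u))%C) k.
Proof.
  intros Hu H1 H2. unfold integrand.
  pose proof (pt_neq0 w1 H1) as N1. pose proof (pt_neq0 w2 H2) as N2.
  replace ((pt w2 ^ v - z ^ v) / pt w2 ^ v + RtoC u * y / pt w1)%C
    with (1 - z ^ v * (/ pt w2) ^ v + RtoC u * y * / pt w1)%C.
  2: { rewrite Cpow_inv by auto. field. split; auto. now apply Cpow_nz. }
  rewrite C_trinomial, triangle_sum_scal. apply triangle_sum_ext. intros l s Hl.
  unfold monomial_coef, hankel_term.
  replace (- RtoC u + pt w1 + pt w2)%C with (RtoC (- u) + pt w1 + pt w2)%C by (rewrite RtoC_opp; ring).
  rewrite !cexp_plus, cexp_RtoC.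
  replace (- (INR l + q + 1)) with (- q - 1 - INR l) by ring.
  replace (- (INR (v * s) - p - q + 1)) with (p + q - 1 - INR (v * s)) by ring.
  rewrite <- !ppow_div by auto.
  replace (gamma_density (INR k + 1 - p + INR l) u) with (exp (- u) * Rpower u (INR k - p) * u ^ l).
  2: { unfold gamma_density. rewrite <- (Rpower_pow l u) by auto. rewrite Rmult_assoc, <- Rpower_plus.
       do 2 f_equal. ring. }
  rewrite !RtoC_mult, RtoC_pow.
  replace (- (RtoC u * y * / pt w1))%C with (RtoC u * - y * / pt w1)%C by ring.
  rewrite !Cpow_mult_l, !Cpow_mult_r. ring.
Qed.

Definition two_pi_i : C := (2 * RtoC PI * Ci)%C.

Definition triple_value (k v : nat) (p q : R) (y z : C) : C :=
  triangle_sum (fun l s =>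
    (monomial_coef k v y z l s * RtoC (Gamma (INR k + 1 - p + INR l))
      * (two_pi_i * RtoC (/ Gamma (INR l + q + 1)))
      * (two_pi_i * RtoC (/ Gamma (INR (v * s) - p - q + 1))))%C) k.

Lemma gamma_arg_not_integer (k l : nat) (p : R) : ~ is_integer p ->
  ~ is_integer (INR k + 1 - p + INR l).
Proof.
  intros Hp [n Hn]. apply Hp. exists (Z.of_nat k + 1 + Z.of_nat l - n)%Z.
  rewrite minus_IZR, !plus_IZR, <- !INR_IZR_INZ. lra.
Qed.

Lemma triple_value_correct (k v : nat) (p q : R) (y z : C) (rho1 rho2 : R) :
  0 < rho1 -> 0 < rho2 -> ~ is_integer p ->
  is_triple_integral rho1 rho2 (integrand k v p q y z) (triple_value k v p q y z).
Proof.
  intros H1 H2 Hp.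
  set (K := monomial_coef k v y z).
  set (g := fun l => RtoC (Gamma (INR k + 1 - p + INR l))).
  set (h1 := fun (l : nat) => hankel_term (- (INR l + q + 1))).
  set (h2 := fun (s : nat) => hankel_term (- (INR (v * s) - p - q + 1))).
  set (a1 := fun l => (two_pi_i * RtoC (/ Gamma (INR l + q + 1)))%C).
  exists (fun w1 w2 => triangle_sum (fun l s => (K l s * g l * h2 s w2 * h1 l w1)%C) k),
    (fun w2 => triangle_sum (fun l s => (K l s * g l * a1 l * h2 s w2)%C) k).
  repeat split.
  - intros w1 w2 Hw1 Hw2.
    apply is_fp_integral_ext with (fun u => triangle_sum (fun l s =>
      (K l s * h2 s w2 * h1 l w1 * RtoC (gamma_density (INR k + 1 - p + INR l) u))%C) k).
    + intros u Hu. rewrite integrand_expand; auto.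
      * apply triangle_sum_ext. intros l s _. unfold K, h1, h2. ring.
      * now apply on_hankel_pos with rho1.
      * now apply on_hankel_pos with rho2.
    + apply (triangle_sum_closed is_fp_integral is_fp_integral_plus (fun l s u =>
        (K l s * h2 s w2 * h1 l w1 * RtoC (gamma_density (INR k + 1 - p + INR l) u))%C)).
      intros l s _.
      replace (K l s * g l * h2 s w2 * h1 l w1)%C with (K l s * h2 s w2 * h1 l w1 * g l)%C by ring.
      apply is_fp_integral_scal, is_fp_integral_gamma. now apply gamma_arg_not_integer.
  - intros w2 _.
    apply (triangle_sum_closed (is_hankel rho1) (is_hankel_plus rho1) (fun l s w1 =>
        (K l s * g l * h2 s w2 * h1 l w1)%C)).
    intros l s _.
    replace (K l s * g l * a1 l * h2 s w2)%C with (K l s * g l * h2 s w2 * a1 l)%C by ring.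
    apply is_hankel_scal. now apply is_hankel_term.
  - apply (triangle_sum_closed (is_hankel rho2) (is_hankel_plus rho2) (fun l s w2 =>
        (K l s * g l * a1 l * h2 s w2)%C)).
    intros l s _. apply is_hankel_scal. now apply is_hankel_term.
Qed.

Lemma RtoC_inv_total (x : R) : (/ RtoC x)%C = RtoC (/ x).
Proof.
  destruct (Req_dec x 0) as [->|Hx]. 2: now rewrite RtoC_inv.
  rewrite Rinv_0. unfold Cinv, RtoC, Rdiv. simpl. f_equal; ring.
Qed.

Definition konhauser_term (k v : nat) (p q : R) (y z : C) (l s : nat) : C :=
  (RtoC (poch (- INR k) (l + s) * poch (INR k + 1 - p) l)
       * (- y) ^ l * z ^ (v * s)
       / RtoC (Gamma (INR l + q + 1) * Gamma (INR (v * s) - p - q + 1)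
               * INR (fact l) * INR (fact s)))%C.

(** Division by Gamma is turned into multiplication by 1 / Gamma, valid at the
    poles as well, which is the form that is continuous in [p]. *)
Lemma konhauser_term_eq (k v : nat) (p q : R) (y z : C) (l s : nat) :
  konhauser_term k v p q y z l s =
  (monomial_coef k v y z l s * RtoC (/ Gamma (INR l + q + 1))
   * RtoC (poch (INR k + 1 - p) l * / Gamma (INR (v * s) - p - q + 1)))%C.
Proof.
  unfold konhauser_term, monomial_coef, Cdiv.
  rewrite RtoC_inv_total. unfold Rdiv. rewrite !Rinv_mult, !RtoC_mult. ring.
Qed.

Lemma prefactor_triple_value (k v : nat) (p q : R) (y z : C) : ~ is_integer p ->
  konhauser_M k v p q y z = (prefactor k p q * triple_value k v p q y z)%C.
Proof.
  intros Hp. unfold konhauser_M, triple_value. rewrite triangle_sum_scal.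
  change (RtoC ((-1) ^ k * Gamma (INR k + q + 1)) * triangle_sum (konhauser_term k v p q y z) k =
    triangle_sum (fun l s => prefactor k p q *
    (monomial_coef k v y z l s * RtoC (Gamma (INR k + 1 - p + INR l))
      * (two_pi_i * RtoC (/ Gamma (INR l + q + 1)))
      * (two_pi_i * RtoC (/ Gamma (INR (v * s) - p - q + 1))))) k)%C.
  rewrite triangle_sum_scal. apply triangle_sum_ext. intros l s _.
  rewrite konhauser_term_eq.
  assert (H0 : ~ is_integer (INR k + 1 - p)).
  { pose proof (gamma_arg_not_integer k 0 p Hp) as H. simpl in H. now rewrite Rplus_0_r in H. }
  rewrite Gamma_poch by auto. pose proof (Gamma_neq0 _ H0) as G0. pose proof PI_RGT_0.
  assert (E : (two_pi_i * two_pi_i)%C = RtoC (- (4 * PI ^ 2))).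
  { unfold two_pi_i. apply C_ext; simpl; ring. }
  unfold prefactor.
  set (G := Gamma (INR k + 1 - p)) in *. set (N := Gamma (INR k + q + 1)).
  set (P := poch (INR k + 1 - p) l). set (ga := / Gamma (INR l + q + 1)).
  set (gb := / Gamma (INR (v * s) - p - q + 1)).
  transitivity (monomial_coef k v y z l s * RtoC ((-1) ^ k * N * ga * (P * gb)))%C.
  { rewrite !RtoC_mult. ring. }
  transitivity (monomial_coef k v y z l s * (two_pi_i * two_pi_i) *
    RtoC ((-1) ^ (k + 1) * N / (4 * PI ^ 2 * G) * (P * G) * ga * gb))%C.
  2: { rewrite !RtoC_mult. ring. }
  rewrite E, <- Cmult_assoc, <- RtoC_mult. do 2 f_equal. rewrite pow_add. simpl ((-1) ^ 1). field. lra.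
Qed.

Lemma continuous_konhauser_M (k v : nat) (p q : R) (y z : C) :
  filterlim (fun p' => konhauser_M k v p' q y z) (locally p) (locally (konhauser_M k v p q y z)).
Proof.
  unfold konhauser_M. apply (lim_C_mult (locally p)). apply filterlim_const.
  apply (triangle_sum_closed (fun f a => filterlim f (locally p) (locally a))
    (fun f g a b => lim_C_plus (locally p) f g a b) (fun l s p' => konhauser_term k v p' q y z l s)
    (konhauser_term k v p q y z) k).
  intros l s _. rewrite konhauser_term_eq.
  apply filterlim_ext with (fun p' =>
    (monomial_coef k v y z l s * RtoC (/ Gamma (INR l + q + 1))
     * RtoC (poch (INR k + 1 - p') l * / Gamma (INR (v * s) - p' - q + 1)))%C).
  { intros p'. symmetry. apply konhauser_term_eq. }
  apply (lim_C_mult (locally p)). apply filterlim_const.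
  apply (lim_C_pair (locally p)); simpl; [|apply filterlim_const].
  apply (lim_mult (locally p)).
  - apply (continuous_comp (fun p' => INR k + 1 - p') (fun a => poch a l)).
    + apply (ex_derive_continuous (fun p' : R => INR k + 1 - p')). auto_derive. exact I.
    + apply continuous_poch.
  - apply (continuous_comp (fun p' => INR (v * s) - p' - q + 1) (fun a => / Gamma a)).
    + apply (ex_derive_continuous (fun p' : R => INR (v * s) - p' - q + 1)). auto_derive. exact I.
    + apply continuous_Rinv_Gamma.
Qed.

Lemma locally'_not_integer (p : R) : is_integer p -> locally' p (fun p' => ~ is_integer p').
Proof.
  intros [n ->]. exists (mkposreal 1 Rlt_0_1). intros x Hx Hne [m ->].
  change (Rabs (IZR m - IZR n) < 1) in Hx. apply Hne. f_equal.
  rewrite <- minus_IZR, <- abs_IZR in Hx. apply lt_IZR in Hx. lia.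
Qed.

Theorem theorem12 (k v : nat) (p q : R) (y z : C) (rho1 rho2 : R)
    (hp : 2 * INR k + 1 < p) (hq : -1 < q) (hv : (1 <= v)%nat)
    (hrho1 : 0 < rho1) (hrho2 : 0 < rho2) :
  (~ is_integer p ->
   exists I : C,
     is_triple_integral rho1 rho2 (integrand k v p q y z) I /\
     konhauser_M k v p q y z = (prefactor k p q * I)%C) /\
  (* At an integer p the factor Gamma (k + 1 - p) has a pole, and the
     right-hand side is understood as its limit in p. *)
  (is_integer p ->
   exists I : R -> C,
     locally' p (fun p' : R =>
       is_triple_integral rho1 rho2 (integrand k v p' q y z) (I p')) /\
     filterlim (fun p' : R => (prefactor k p' q * I p')%C)
       (locally' p) (locally (konhauser_M k v p q y z))).
Proof.
  split.
  - intros Hp. exists (triple_value k v p q y z). split.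
    + now apply triple_value_correct.
    + now apply prefactor_triple_value.
  - intros Hp. exists (fun p' => triple_value k v p' q y z). split.
    + apply filter_imp with (2 := locally'_not_integer p Hp). intros p' Hp'.
      now apply triple_value_correct.
    + apply filterlim_ext_loc with (fun p' => konhauser_M k v p' q y z).
      * apply filter_imp with (2 := locally'_not_integer p Hp). intros p' Hp'.
        now apply prefactor_triple_value.
      * apply filterlim_filter_le_1 with (2 := continuous_konhauser_M k v p q y z).
        intros P. unfold locally', within. apply filter_imp. auto.
Qed.
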